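(* Let $\bar{\mathbf y}\in\arg\min E_{\mathbf f}$ and $\bar{\mathbf y}_{\mathrm{ac}}\in\arg\min E^{\mathrm{ac}}_{\mathbf f}$ satisfy $$\min\bar{\mathbf y}',\ \min\bar{\mathbf y}'_{\mathrm{ac}}\ \ge\ s_0\ \ge\ \varsigma_0\qquad\text{and}\qquad \max\bar{\mathbf y}',\ \max\bar{\mathbf y}'_{\mathrm{ac}}\ \le\ S_0<+\infty .$$ There exist constants $c$ and $C=C(s_0,S_0)$ such that, if $\Delta a\ge c\log(S_0)$ (with $\Delta a=\Delta a(\mathbf y)$ for $\mathbf y=\bar{\mathbf y}$ and $\mathbf y=\bar{\mathbf y}_{\mathrm{ac}}$), then $$\bigl\|\bar{\mathbf y}'-\bar{\mathbf y}'_{\mathrm{ac}}\bigr\|_{\ell^2_\varepsilon}\ \le\ C\Bigl(\varepsilon\,\|\bar{\mathbf y}''\|_{\ell^2_{w,s_0}}+\tau\Bigr),$$ where $\tau=\exp\bigl(-\tfrac m\varepsilon\Delta a(\bar{\mathbf y})\bigr)$.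
   Context: Basic setting. Fix $m>0$, $F>0$, $\varsigma_0>0$ and a smooth, nonnegative, even function $\delta_1$ on $\mathbb R$ supported in $[-\varsigma_0/2,\varsigma_0/2]$ with $\int_{\mathbb R}\delta_1\,dx=1$. For $N\in\mathbb N$ let $\varepsilon=2/(2N+1)$ and $\delta_\varepsilon(x)=\varepsilon^{-1}\delta_1(x/\varepsilon)$. Let $\mathcal U=\{\mathbf u\in\mathbb R^{\mathbb Z}:u_{j+2N+1}=u_j\ \forall j,\ \sum_{j=-N}^Nu_j=0\}$ and $\mathcal Y=\{(F\varepsilon j+u_j)_{j\in\mathbb Z}:\mathbf u\in\mathcal U\}$. For $\mathbf y$ in $\mathcal Y$ or $\mathcal U$: $y_j'=(y_j-y_{j-1})/\varepsilon$, $y_j''=(y_{j+1}-2y_j+y_{j-1})/\varepsilon^2$; $\min\mathbf y'=\min_jy_j'$, $\max\mathbf y'=\max_jy'_j$. $\|\mathbf v\|_{\ell^2_\varepsilon}^2=\varepsilon\sum_{j=-N}^Nv_j^2$. In one dimension $\nabla$ denotes the derivative in $x$. Atomistic energy. For $\mathbf y\in\mathcal Y$ let $\Omega=(y_{-N-1},y_N)$ (of length $2F$), $\rho_{\mathbf y}=\varepsilon\sum_{j\in\mathbb Z}\delta_\varepsilon(\cdot-y_j)$, and, with $H^1_\#(\Omega)$ the periodic $H^1$ functions on $\Omega$, $$\mathcal E(\mathbf y)=-\min_{\varphi\in H^1_\#(\Omega)}\int_\Omega\bigl(\tfrac12\varepsilon^2|\nabla\varphi|^2+\tfrac12m^2\varphi^2-\rho_{\mathbf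 y}\varphi\bigr)dx .$$ Cauchy--Born cell energy. For $\mathbf y\in\mathcal Y$ with $\mathbf y'>0$ and $Q_j=(y_{j-1},y_j)$, $$\mathcal E^{\mathrm{cb}}_j(\mathbf y)=-\min_{\psi\in H^1_\#(Q_j)}\int_{Q_j}\bigl(\tfrac12\varepsilon^2|\nabla\psi|^2+\tfrac12m^2\psi^2-\rho_{\mathbf y}\psi\bigr)dx .$$ Coupled (a/c) energy. Fix $K<N$. Put $a_L(\mathbf y)=\tfrac12(y_{-K-1}+y_{-K})$, $a_R(\mathbf y)=\tfrac12(y_K+y_{K+1})$, $\Delta a(\mathbf y)=a_R(\mathbf y)-a_L(\mathbf y)$, $\Omega^{\mathrm{at}}=(a_L(\mathbf y),a_R(\mathbf y))$, $\rho^{\mathrm{at}}_{\mathbf y}=\varepsilon\sum_{j=-K}^K\delta_\varepsilon(\cdot-y_j)$. Let $G_\varepsilon(x)=\frac1{2\varepsilon m}e^{-\frac m\varepsilon|x|}$, $\gamma_L(\mathbf y)=2\int_{\Omega^{\mathrm{at}}}\rho^{\mathrm{at}}_{\mathbf y}(x)G_\varepsilon(x-a_L(\mathbf y))dx$, $\gamma_R(\mathbf y)=2\int_{\Omega^{\mathrm{at}}}\rho^{\mathrm{at}}_{\mathbf y}(x)G_\varepsilon(a_R(\mathbf y)-x)dx$, and, with $\tau=\tau(\mathbf y)=e^{-\frac m\varepsilon\Delta a(\mathbf y)}$, $$g_L^*(\mathbf y)=\frac{\gamma_L+\tau\gamma_R}{(1-\tau)(1+\tau)},\qquad g_R^*(\mathbf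 y)=\frac{\tau\gamma_L+\gamma_R}{(1-\tau)(1+\tau)} .$$ Define $$\mathcal E^{\mathrm{at}}_*(\mathbf y)=-\min\Bigl\{\int_{\Omega^{\mathrm{at}}}\bigl(\tfrac12\varepsilon^2|\nabla\varphi|^2+\tfrac12m^2\varphi^2-\rho^{\mathrm{at}}_{\mathbf y}\varphi\bigr)dx:\ \varphi\in H^1(\Omega^{\mathrm{at}}),\ \varphi(a_L)=g_L^*(\mathbf y),\ \varphi(a_R)=g_R^*(\mathbf y)\Bigr\},$$ $$\mathcal E^{\mathrm{cb}}_*(\mathbf y)=\sum_{j=-N}^{-K-1}\mathcal E^{\mathrm{cb}}_j(\mathbf y)+\tfrac12\mathcal E^{\mathrm{cb}}_{-K}(\mathbf y)+\tfrac12\mathcal E^{\mathrm{cb}}_{K+1}(\mathbf y)+\sum_{j=K+2}^N\mathcal E^{\mathrm{cb}}_j(\mathbf y),\qquad \mathcal E^{\mathrm{ac}}=\mathcal E^{\mathrm{cb}}_*+\mathcal E^{\mathrm{at}}_* .$$ Total energies. For an external force $\mathbf f$ (an element of the dual of $\mathcal U$, represented via $(\mathbf f,\mathbf y)_\varepsilon=\varepsilon\sum_{j=-N}^Nf_jy_j$), $E_{\mathbf f}(\mathbf y)=\mathcal E(\mathbf y)+(\mathbf f,\mathbf y)_\varepsilon$ on $\mathcal Y$ and $E^{\mathrm{ac}}_{\mathbf f}(\mathbf y)=\mathcal E^{\mathrm{ac}}(\mathbf y)+(\mathbf f,\mathbf y)_\varepsilon$ on $\{\mathbf y\in\mathcal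 Y:\mathbf y'>0\}$; $\arg\min$ is over these sets. Weighted norm. $\|\mathbf y''\|^2_{\ell^2_{w,s_0}}=\varepsilon\sum_{j=-N}^Nw_j|y_j''|^2$ with $w_j=1$ if $|j|\ge K$ and $w_j=e^{-ms_0\,\mathrm{dist}(j,\{-K,K\})}$ if $|j|<K$. Constants $c$, $C$ may depend on $m$ and $\delta_1$ (and on the displayed arguments; $c$ may also depend on $s_0$), but not on $\varepsilon$, $N$, $K$, $\mathbf f$ or the configurations. *)

(* Defs.v *)
From HB Require Import structures.
From mathcomp Require Import all_boot all_order all_algebra.
From mathcomp Require Import all_classical all_reals all_analysis.
Import Order.TTheory GRing.Theory Num.Theory.
Import numFieldNormedType.Exports.

Set Implicit Arguments.
Unset Strict Implicit.
Unset Printing Implicit Defensive.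

Local Open Scope classical_set_scope.
Local Open Scope ring_scope.

Section Sobolev.
Variable R : realType.
Implicit Types (a b e : R) (phi g psi rho : R -> R).

Local Notation mu := (@lebesgue_measure R).

(* The space C^1_c(]a, b[) *)
Definition test_fun a b psi : Prop :=
  [/\ forall x, derivable psi x 1,
      continuous (derive1 psi),
      compact (closure [set x | psi x != 0])
    & closure [set x | psi x != 0] `<=` `]a, b[].

Definition weak_derivative a b phi g : Prop :=
  forall psi, test_fun a b psi ->
    \int[mu]_(x in `]a, b[) (phi x * derive1 psi x) =
    - \int[mu]_(x in `]a, b[) (g x * psi x).

(* [H1 a b phi g]: [phi] is the continuous representative on [a, b] of an
   element of H^1(]a, b[) and [g], in L^2(]a, b[), is its weak derivative.
   Square integrability of [phi] follows from continuity on [a, b].  Traces at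
   the end points are the values [phi a] and [phi b]. *)
Definition H1 a b phi g : Prop :=
  [/\ {within `[a, b], continuous phi},
      measurable_fun `]a, b[ g,
      mu.-integrable `]a, b[ (fun x => (g x ^+ 2)%:E)
    & weak_derivative a b phi g].

Definition field_functional (e m : R) rho a b phi g : R :=
  \int[mu]_(x in `]a, b[)
    (e ^+ 2 / 2 * g x ^+ 2 + m ^+ 2 / 2 * phi x ^+ 2 - rho x * phi x).

(* For a < b, e, m > 0 and rho bounded measurable, the minima below are
   attained, so that [inf] is the minimum. *)
Definition periodic_energy (e m : R) rho a b : R :=
  - inf [set J | exists phi g,
      [/\ H1 a b phi g, phi a = phi b & J = field_functional e m rho a b phi g]].

Definition dirichlet_energy (e m : R) rho a b (ga gb : R) : R :=
  - inf [set J | exists phi g,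
      [/\ H1 a b phi g, phi a = ga, phi b = gb
        & J = field_functional e m rho a b phi g]].

End Sobolev.

Section Chain.
Variable R : realType.
Implicit Types (y u v f : int -> R) (N K n : nat) (j : int).

Local Notation mu := (@lebesgue_measure R).

Definition eps N : R := 2 / (N.*2.+1)%:R.

(* \sum_(j = -n)^n v_j *)
Definition sum_sym n v : R := \sum_(0 <= i < n.*2.+1) v (i%:Z - n%:Z).

Definition displacements N u : Prop :=
  (forall j, u (j + (N.*2.+1)%:Z) = u j) /\ sum_sym N u = 0.

Definition deformations (F : R) N y : Prop :=
  exists2 u, displacements N u & forall j, y j = F * eps N * j%:~R + u j.

Definition d1 N y : int -> R := fun j => (y j - y (j - 1)) / eps N.

Definition d2 N y : int -> R :=
  fun j => (y (j + 1) - 2 * y j + y (j - 1)) / eps N ^+ 2.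

Definition norm_l2 N v : R := Num.sqrt (eps N * sum_sym N (fun j => v j ^+ 2)).

Definition weight (m s0 : R) K j : R :=
  if (K%:Z <= `|j|) then 1
  else expR (- m * s0 * (Num.min `|j + K%:Z| `|j - K%:Z|)%:~R).

Definition wnorm_l2 (m s0 : R) N K v : R :=
  Num.sqrt (eps N * sum_sym N (fun j => weight m s0 K j * v j ^+ 2)).

Definition charge_profile (vs0 : R) (delta1 : R -> R) : Prop :=
  [/\ forall n x, derivable (derive1n n delta1) x 1,
      forall x, 0 <= delta1 x,
      forall x, delta1 (- x) = delta1 x,
      forall x, delta1 x != 0 -> - (vs0 / 2) <= x <= vs0 / 2
    & mu.-integrable setT (fun x => (delta1 x)%:E) /\
      \int[mu]_(x in setT) delta1 x = 1].

Variables (m : R) (delta1 : R -> R).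

Definition delta_eps N (x : R) : R := (eps N)^-1 * delta1 (x / eps N).

(* For a deformation [y] and fixed [x] only finitely many terms are nonzero,
   since y (j + 2N + 1) = y j + 2F; the finitely supported sum over [int] is
   then the full series. *)
Definition rho N y (x : R) : R :=
  eps N * \sum_(j \in [set: int]) delta_eps N (x - y j).

Definition energy N y : R :=
  periodic_energy (eps N) m (rho N y) (y (- (N.+1)%:Z)) (y N%:Z).

Definition energy_cb_cell N y j : R :=
  periodic_energy (eps N) m (rho N y) (y (j - 1)) (y j).

Definition aL K y : R := (y (- (K.+1)%:Z) + y (- K%:Z)) / 2.
Definition aR K y : R := (y K%:Z + y (K.+1)%:Z) / 2.
Definition Da K y : R := aR K y - aL K y.

Definition rho_at N K y (x : R) : R :=
  eps N * sum_sym K (fun j => delta_eps N (x - y j)).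

Definition green N (x : R) : R :=
  (2 * eps N * m)^-1 * expR (- (m / eps N) * `|x|).

Definition gammaL N K y : R :=
  2 * \int[mu]_(x in `]aL K y, aR K y[) (rho_at N K y x * green N (x - aL K y)).

Definition gammaR N K y : R :=
  2 * \int[mu]_(x in `]aL K y, aR K y[) (rho_at N K y x * green N (aR K y - x)).

Definition tau N K y : R := expR (- (m / eps N) * Da K y).

Definition gL_star N K y : R :=
  (gammaL N K y + tau N K y * gammaR N K y)
    / ((1 - tau N K y) * (1 + tau N K y)).

Definition gR_star N K y : R :=
  (tau N K y * gammaL N K y + gammaR N K y)
    / ((1 - tau N K y) * (1 + tau N K y)).

Definition energy_at_star N K y : R :=
  dirichlet_energy (eps N) m (rho_at N K y) (aL K y) (aR K y)
    (gL_star N K y) (gR_star N K y).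

(* The first sum runs over the cells j = -i, i.e. from -N to -K-1. *)
Definition energy_cb_star N K y : R :=
  \sum_(K.+1 <= i < N.+1) energy_cb_cell N y (- i%:Z)
  + energy_cb_cell N y (- K%:Z) / 2
  + energy_cb_cell N y (K.+1)%:Z / 2
  + \sum_(K.+2 <= i < N.+1) energy_cb_cell N y i%:Z.

Definition energy_ac N K y : R := energy_cb_star N K y + energy_at_star N K y.

(* A linear functional on displacements is represented by a sequence [f], of
   which only the values at -N, ..., N matter. *)
Definition pairing N f y : R := eps N * sum_sym N (fun j => f j * y j).

Definition total_energy N f y : R := energy N y + pairing N f y.

Definition total_energy_ac N K f y : R := energy_ac N K y + pairing N f y.

End Chain.

Definition argmin (R : realType) (T : Type) (A : set T) (E : T -> R) : set T :=
  [set y | A y /\ forall z, A z -> E y <= E z].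

(* Main.v *)
(** Where consecutive charges are at least [vs0] apart, the fields can be solved
explicitly and every energy is, up to constants independent of the
configuration, a multiple of an interaction sum [Phi] of terms exp(- m L), with
L the length of a window of consecutive bonds: for the full chain all windows,
for a Cauchy-Born cell those of the homogeneous chain with the bond of the cell,
and for the atomistic region (whose boundary data are the Neumann values) half
of those of the chain reflected at the interfaces.

All these terms are convex in the bonds and the nearest-neighbour ones strongly
so, hence the coupled energy is strongly convex along the segment between the
two minimizers.  Comparing both energies on this segment cancels the force and
leaves the stress difference at the atomistic minimizer.  It is a sum, over the
windows containing a given bond, of the effect of replacing the bonds of the
window by copies of that bond or by reflected bonds; this effect is controlled
by second differences, and the decay exp(- m s0 length) pays for the weights. *)

Require Import Defs.
From HB Require Import structures.
From mathcomp Require Import all_boot all_order all_algebra.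
From mathcomp Require Import all_classical all_reals all_analysis.
From mathcomp Require Import measurable_realfun ring lra zify.
Import Order.TTheory GRing.Theory Num.Theory.
Import numFieldNormedType.Exports.
Local Open Scope classical_set_scope.
Local Open Scope ring_scope.

Set Implicit Arguments.
Unset Strict Implicit.
Unset Printing Implicit Defensive.

(** * Weak solutions and the minimal field energy *)

(** Neither energy is ever differentiated. Minimality is used at a finite step t: the atomistic
    minimizer is compared with the point a fraction t along the segment, the coupled one with the
    point a fraction t before its end. Adding the two inequalities removes the force. Convexity
    enters through inequalities between values of exp, and t tends to 0 only at the very end.
    Likewise no infinite series is manipulated: the estimates concern the first n shells, uniformly
    in n, and only the limits in n are identified with energies.

    Two facts turn energies into interaction sums. Outside its support a charge acts as a point
    charge of strength [kappa], equal on both sides because [delta1] is even. Its self-interaction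
    [dinf] is the same for every charge and cancels in energy differences.

    The decay exp(- m s0 k) of a window of k bonds is split evenly as th^k th^k. One half sums the
    powers of k that count windows and bonds. The other is exchanged for the square root of the
    weight, because such a window only sees second differences at depth at most k in the atomistic
    region. *)

Definition C1 {R : realType} (f df : R -> R) : Prop :=
  (forall x : R, is_derive x (1 : R) f (df x)) /\ continuous df.

Section C1.
Variable R : realType.
Implicit Types f g df dg : R -> R.
Local Notation mu := (@lebesgue_measure R).

Lemma C1_continuous f df : C1 f df -> continuous f.
Proof.
move=> [fd _] x; apply: differentiable_continuous.
by apply/derivable1_diffP; have [] := fd x.
Qed.

Lemma C1_derive f df : C1 f df -> derive1 f = df.
Proof. by move=> [fd _]; apply/funext => x; rewrite derive1E; have [] := fd x. Qed.

Lemma C1_ext f df g dg : f =1 g -> df =1 dg -> C1 f df -> C1 g dg.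
Proof. by move=> /funext <- /funext <-. Qed.

Lemma C1_cst c : C1 (fun _ : R => c) (fun=> 0).
Proof. by split; [move=> x; exact: is_derive_cst|exact: cst_continuous]. Qed.

Lemma C1_id : C1 (fun x : R => x) (fun=> 1).
Proof. by split; [move=> x; exact: is_derive_id|exact: cst_continuous]. Qed.

Lemma C1D f df g dg : C1 f df -> C1 g dg ->
  C1 (fun x => f x + g x) (fun x => df x + dg x).
Proof.
move=> [fd fc] [gd gc]; split => [x|x]; last exact: (cvgD (fc x) (gc x)).
exact: is_deriveD (fd x) (gd x).
Qed.

Lemma C1N f df : C1 f df -> C1 (fun x => - f x) (fun x => - df x).
Proof.
move=> [fd fc]; split => [x|x]; last exact: (cvgN (fc x)).
exact: is_deriveN (fd x).
Qed.

Lemma C1B f df g dg : C1 f df -> C1 g dg ->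
  C1 (fun x => f x - g x) (fun x => df x - dg x).
Proof. by move=> hf hg; exact: C1D hf (C1N hg). Qed.

Lemma C1M f df g dg : C1 f df -> C1 g dg ->
  C1 (fun x => f x * g x) (fun x => f x * dg x + g x * df x).
Proof.
move=> hf hg; case: (hf) (hg) => [fd fc] [gd gc]; split => [x|x].
  exact: is_deriveM (fd x) (gd x).
apply: cvgD; apply: cvgM; [exact: C1_continuous hf x|exact: gc|
  exact: C1_continuous hg x|exact: fc].
Qed.

Lemma C1Z c f df : C1 f df -> C1 (fun x => c * f x) (fun x => c * df x).
Proof.
move=> hf; apply: C1_ext (C1M (C1_cst c) hf) => // x.
by rewrite /= mulr0 addr0.
Qed.

Lemma C1_sum (I : Type) (s : seq I) (f df : I -> R -> R) :
  (forall i, C1 (f i) (df i)) ->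
  C1 (fun x => \sum_(i <- s) f i x) (fun x => \sum_(i <- s) df i x).
Proof.
move=> h; elim: s => [|i s ih].
  by apply: C1_ext (C1_cst 0) => x; rewrite big_nil.
by apply: C1_ext (C1D (h i) ih) => x; rewrite big_cons.
Qed.

Lemma C1_comp f df g dg : C1 f df -> C1 g dg ->
  C1 (fun x => f (g x)) (fun x => df (g x) * dg x).
Proof.
move=> [fd fc] hg; case: (hg) => [gd gc]; split => [x|x].
  exact: (@is_derive1_comp _ f g x _ _ (fd (g x)) (gd x)).
apply: cvgM; last exact: gc.
by apply: (@continuous_comp _ _ _ g df); [exact: C1_continuous hg x|exact: fc].
Qed.

Lemma C1_affine (a b : R) : C1 (fun x => a * x + b) (fun=> a).
Proof.
apply: C1_ext (C1D (C1Z a C1_id) (C1_cst b)) => // x.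
by rewrite mulr1 addr0.
Qed.

Lemma C1_expZ (a : R) : C1 (fun x => expR (a * x)) (fun x => a * expR (a * x)).
Proof.
have hexp : C1 (@expR R) expR.
  by split; [move=> x; exact: is_derive_expR|exact: continuous_expR].
have := C1_comp hexp (C1_affine a 0).
by apply: C1_ext => x; rewrite addr0// mulrC.
Qed.

Lemma within_continuousT (A : set R) f : continuous f -> {within A, continuous f}.
Proof. by move=> cf; apply: continuous_subspaceT. Qed.

Lemma within_continuousM (A : set R) f g : {within A, continuous f} ->
  {within A, continuous g} -> {within A, continuous (fun x => f x * g x)}.
Proof. by move=> cf cg x; apply: continuousM; [exact: cf|exact: cg]. Qed.

Lemma integrable_oo_cc (a b : R) f : mu.-integrable `[a, b] (EFin \o f) ->
  mu.-integrable `]a, b[ (EFin \o f).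
Proof. by apply: integrableS => //; exact: subset_itv_oo_cc. Qed.

Lemma within_integrable_oo (a b : R) f :
  {within `[a, b], continuous f} -> mu.-integrable `]a, b[ (EFin \o f).
Proof.
move=> cf; apply: integrable_oo_cc; apply: continuous_compact_integrable => //.
exact: segment_compact.
Qed.

Lemma Rintegral_oo_cc (a b : R) f : mu.-integrable `[a, b] (EFin \o f) ->
  \int[mu]_(x in `]a, b[) f x = \int[mu]_(x in `[a, b]) f x.
Proof.
move=> fi; rewrite Rintegral_itv_bndo_bndc; last exact: integrable_oo_cc.
rewrite Rintegral_itv_obnd_cbnd//.
by apply: integrableS fi => //; apply: subset_itvr; rewrite bnd_simp.
Qed.

Lemma C1_FTC2 (a b : R) f df : a < b -> C1 f df ->
  \int[mu]_(x in `]a, b[) df x = f b - f a.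
Proof.
move=> ab hf; case: (hf) => fd dfc.
have wdf := @within_continuousT `[a, b] _ dfc.
rewrite Rintegral_oo_cc; last first.
  by apply: continuous_compact_integrable => //; exact: segment_compact.
rewrite /Rintegral (@continuous_FTC2 R df f a b)//.
- split; first by move=> x _; have [] := fd x.
  + exact/cvg_at_right_filter/(C1_continuous hf).
  + exact/cvg_at_left_filter/(C1_continuous hf).
- by move=> x _; rewrite (C1_derive hf).
Qed.

End C1.

(** * Cutoffs and boundary traces *)

Section boundary_parts.
Variable R : realType.
Implicit Types (f g F phi psi : R -> R) (a b : R).
Local Notation mu := (@lebesgue_measure R).

(** A criterion suited to x |x|, whose remainder is estimated by cases on signs where no second
    derivative exists at 0. *)
Lemma is_derive_quadratic f (x d C : R) :
  (forall h, `|f (x + h) - f x - h * d| <= C * h ^+ 2) -> is_derive x (1 : R) f d.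
Proof.
move=> fC.
have C0 : 0 <= C by have := fC 1; rewrite expr1n mulr1; apply: le_trans.
have L : (fun h : R => h^-1 *: (f (h *: 1 + x) - f x)) @ 0^' --> d.
  apply/cvgrPdist_le => e e0; near=> h.
  have h0 : h != 0 by near: h; exact: nbhs_dnbhs_neq.
  rewrite /GRing.scale/= mulr1 (addrC h) distrC.
  have -> : h^-1 * (f (x + h) - f x) - d = h^-1 * (f (x + h) - f x - h * d).
    by field.
  rewrite normrM normfV ler_pdivrMl ?normr_gt0//.
  apply: (le_trans (fC h)); rewrite -real_normK ?num_real// expr2 mulrCA.
  apply: ler_wpM2l => //; have : `|h| <= e / (C + 1).
    by near: h; apply: dnbhs0_le; rewrite divr_gt0// ltr_wpDl.
  rewrite ler_pdivlMr ?ltr_wpDl// => hh.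
  by apply: le_trans hh; rewrite mulrC ler_wpM2l// lerDl.
apply: DeriveDef; first by apply/cvg_ex; exists d.
by rewrite /derive; exact: cvg_lim L.
Unshelve. all: by end_near. Qed.

Lemma C1_mul_norm : C1 (fun x : R => x * `|x|) (fun x => 2 * `|x|).
Proof.
split => x; last by apply: cvgM; [exact: cvg_cst|exact: norm_continuous].
apply: (@is_derive_quadratic _ _ _ 1) => h; rewrite mul1r ler_norml.
by do 2 (case: ger0P => ?); nra.
Qed.

(* A C^1 quadratic spline from 0 (left of -1) to 1 (right of 1). *)
Definition step (t : R) : R :=
  2^-1 + 4^-1 * ((t + 1) * `|t + 1| + ((t - 1) * `|t - 1| - 2 * (t * `|t|))).

Definition dstep (t : R) : R :=
  4^-1 * (2 * `|t + 1| + (2 * `|t - 1| - 2 * (2 * `|t|))).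

Lemma C1_step : C1 step dstep.
Proof.
have h c : C1 (fun t : R => (t + c) * `|t + c|) (fun t => 2 * `|t + c|).
  have := C1_comp C1_mul_norm (C1_affine 1 c).
  by apply: C1_ext => t; rewrite mul1r ?mulr1.
have := C1D (C1_cst 2^-1) (C1Z 4^-1 (C1D (h 1) (C1B (h (-1)) (C1Z 2 C1_mul_norm)))).
by apply: C1_ext => t; rewrite ?add0r.
Qed.

Lemma step_le t : t <= -1 -> step t = 0.
Proof.
by move=> ?; rewrite /step !ler0_norm; [field|lra..].
Qed.

Lemma step_ge t : 1 <= t -> step t = 1.
Proof.
by move=> ?; rewrite /step !ger0_norm; [field|lra..].
Qed.

Lemma dstep_ge0 t : 0 <= dstep t.
Proof.
rewrite /dstep; case: (ger0P (t + 1)) => ?; case: (ger0P (t - 1)) => ?.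
all: by case: (ger0P t) => ?; lra.
Qed.

Lemma dstep_le t : t <= -1 -> dstep t = 0.
Proof. by move=> ?; rewrite /dstep !ler0_norm; [field|lra..]. Qed.

Lemma dstep_ge t : 1 <= t -> dstep t = 0.
Proof. by move=> ?; rewrite /dstep !ger0_norm; [field|lra..]. Qed.

Lemma step_itv t : 0 <= step t <= 1.
Proof.
have [t1|t1] := leP t (-1); first by rewrite step_le// lexx ler01.
have [t2|t2] := leP 1 t; first by rewrite step_ge// lexx ler01.
rewrite /step (ger0_norm (_ : 0 <= t + 1)); last lra.
rewrite (ler0_norm (_ : t - 1 <= 0)); last lra.
by case: (ger0P t) => ?; apply/andP; split; nra.
Qed.

(** [ds] is a probability density on ]a, b[, so the integral is an average of values of [F] within
    [eta] of [c]. *)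
Lemma Rintegral_kernel_dist a b F s ds (c eta : R) : a < b ->
  {within `[a, b], continuous F} -> C1 s ds ->
  (forall x, 0 <= ds x) -> s b - s a = 1 ->
  (forall x, a < x < b -> ds x != 0 -> `|F x - c| <= eta) ->
  `|\int[mu]_(x in `]a, b[) (F x * ds x) - c| <= eta.
Proof.
move=> ab cF hs ds0 s1 Fc; case: (hs) => _ cds.
have int1 : \int[mu]_(x in `]a, b[) ds x = 1 by rewrite (C1_FTC2 ab hs).
have ids : mu.-integrable `]a, b[ (EFin \o ds).
  by apply: within_integrable_oo; exact: within_continuousT.
have iFds : mu.-integrable `]a, b[ (EFin \o (fun x => F x * ds x)).
  apply: within_integrable_oo => x; apply: continuousM; first exact: cF.
  exact: within_continuousT.
have iZ k : mu.-integrable `]a, b[ (EFin \o (fun x => k * ds x)).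
  apply: within_integrable_oo; apply: within_continuousT => x.
  by apply: cvgM; [exact: cvg_cst|exact: cds].
rewrite ler_norml lerBlDr lerBrDr; apply/andP; split.
- rewrite -[leLHS]mulr1 -int1 -RintegralZl//.
  apply: le_Rintegral => // x /=; rewrite in_itv/= => xab.
  have [->|dx0] := eqVneq (ds x) 0; first by rewrite !mulr0.
  by apply: ler_wpM2r => //; move: (Fc _ xab dx0); rewrite ler_norml; lra.
- rewrite -[leRHS]mulr1 -int1 -RintegralZl//.
  apply: le_Rintegral => // x /=; rewrite in_itv/= => xab.
  have [->|dx0] := eqVneq (ds x) 0; first by rewrite !mulr0.
  by apply: ler_wpM2r => //; move: (Fc _ xab dx0); rewrite ler_norml; lra.
Qed.

(** Rises on [a + h, a + 3 h] and falls on [b - 3 h, b - h]. A sum minus 1 rather than a product, so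
    that the derivative is a difference of two kernels of unit mass, one at each end. *)
Definition cutoff a b h (x : R) : R :=
  step ((x - a) / h - 2) + step ((b - x) / h - 2) - 1.

Definition dcutoff a b h (x : R) : R :=
  dstep ((x - a) / h - 2) / h - dstep ((b - x) / h - 2) / h.

Lemma C1_step_left a h :
  C1 (fun x => step ((x - a) / h - 2)) (fun x => dstep ((x - a) / h - 2) / h).
Proof.
have := C1_comp C1_step (C1_affine h^-1 (- (a / h) - 2)).
have e (x : R) : h^-1 * x + (- (a / h) - 2) = (x - a) / h - 2 by ring.
by apply: C1_ext => x; rewrite e.
Qed.

Lemma C1_step_right b h : C1 (fun x => step ((b - x) / h - 2))
  (fun x => - (dstep ((b - x) / h - 2) / h)).
Proof.
have := C1_comp C1_step (C1_affine (- h^-1) (b / h - 2)).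
have e (x : R) : - h^-1 * x + (b / h - 2) = (b - x) / h - 2 by ring.
by apply: C1_ext => x; rewrite e// mulrN.
Qed.

Lemma C1_cutoff a b h : C1 (cutoff a b h) (dcutoff a b h).
Proof.
have := C1B (C1D (C1_step_left a h) (C1_step_right b h)) (C1_cst 1).
by apply: C1_ext => x; rewrite ?subr0.
Qed.

Lemma cutoff_norm a b h x : `|cutoff a b h x| <= 1.
Proof.
rewrite /cutoff ler_norml.
have := step_itv ((x - a) / h - 2); have := step_itv ((b - x) / h - 2); lra.
Qed.

Lemma cutoff_eq0 a b h x : 0 < h -> 4 * h <= b - a ->
  (x <= a + h) || (b - h <= x) -> cutoff a b h x = 0.
Proof.
move=> h0 hab /orP[] xh; rewrite /cutoff.
- rewrite step_le ?step_ge ?add0r ?subrr//.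
    by rewrite lerBrDr ler_pdivlMr//; lra.
  by rewrite lerBlDr ler_pdivrMr//; lra.
- rewrite step_ge ?step_le ?addr0 ?subrr//.
    by rewrite lerBlDr ler_pdivrMr//; lra.
  by rewrite lerBrDr ler_pdivlMr//; lra.
Qed.

Lemma cutoff_eq1 a b h x : 0 < h -> a + 3 * h <= x <= b - 3 * h ->
  cutoff a b h x = 1.
Proof.
move=> h0 xh; rewrite /cutoff !step_ge ?addrK// lerBrDr ler_pdivlMr//; lra.
Qed.

Lemma test_fun_cutoff a b h psi dpsi : 0 < h -> 4 * h <= b - a ->
  C1 psi dpsi -> test_fun a b (fun x => psi x * cutoff a b h x).
Proof.
move=> h0 hab hpsi; have hp := C1M hpsi (C1_cutoff a b h).
have sub : closure [set x | psi x * cutoff a b h x != 0] `<=` `[a + h, b - h].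
  rewrite [X in _ `<=` X](closure_id _).1; last exact: interval_closed.
  apply: closure_subset => x /=; rewrite in_itv/=; apply: contra_neqT.
  rewrite negb_and -!ltNge => xh; rewrite cutoff_eq0 ?mulr0//.
  by case/orP: xh => /ltW ->; rewrite ?orbT.
split.
- by move=> x; have [/(_ x)[]] := hp.
- by rewrite (C1_derive hp); case: hp.
- by apply: (subclosed_compact _ (@segment_compact _ (a + h) (b - h)) sub);
    exact: closed_closure.
- by apply: (subset_trans sub); apply: subset_itv; rewrite bnd_simp; lra.
Qed.

Lemma near_bnd_le a b F (c eta : R) : a < b -> {within `[a, b], continuous F} ->
  0 < eta -> c = a \/ c = b ->
  exists2 d, 0 < d & forall x, a < x < b -> `|x - c| <= d -> `|F x - F c| <= eta.
Proof.
move=> ab /(continuous_within_itvP _ ab)[_ Fa Fb] eta0 [->|->].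
- move/cvgrPdist_le : Fa => /(_ _ eta0)[d /= d0 dF].
  exists (d / 2); first by rewrite divr_gt0.
  move=> x /andP[ax _] xd; rewrite distrC; apply: dF => //=.
  by rewrite distrC (le_lt_trans xd)//; lra.
- move/cvgrPdist_le : Fb => /(_ _ eta0)[d /= d0 dF].
  exists (d / 2); first by rewrite divr_gt0.
  move=> x /andP[_ xb] xd; rewrite distrC; apply: dF => //=.
  by rewrite distrC (le_lt_trans xd)//; lra.
Qed.

Lemma Rintegral_dcutoff a b F eta : a < b -> {within `[a, b], continuous F} ->
  0 < eta -> exists2 d, 0 < d & forall h, 0 < h -> h <= d ->
  4 * h <= b - a ->
  `|\int[mu]_(x in `]a, b[) (F x * dcutoff a b h x) - (F a - F b)| <= eta.
Proof.
move=> ab cF eta0; have eta2 : 0 < eta / 2 by rewrite divr_gt0.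
have [d1 d10 Fa] := near_bnd_le ab cF eta2 (or_introl erefl).
have [d2 d20 Fb] := near_bnd_le ab cF eta2 (or_intror erefl).
(* Both kernels live within 3 h of their end point. *)
exists (Num.min d1 d2 / 3); first by rewrite divr_gt0// lt_min d10.
move=> h h0; rewrite ler_pdivlMr// le_min => /andP[hd1 hd2] hab.
pose dl x := dstep ((x - a) / h - 2) / h.
pose dr x := dstep ((b - x) / h - 2) / h.
have hl : C1 _ dl := C1_step_left a h.
have hr : C1 (fun x => - step ((b - x) / h - 2)) dr.
  by have := C1N (C1_step_right b h); apply: C1_ext => x; rewrite ?opprK.
have small u : dstep (u / h - 2) / h != 0 -> `|u| <= h * 3.
  move=> dl0; rewrite ler_norml; apply/andP; split.
  - rewrite leNgt; apply: contra_neqN dl0 => ?.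
    by rewrite dstep_le ?mul0r// lerBlDr ler_pdivrMr//; lra.
  - rewrite leNgt; apply: contra_neqN dl0 => ?.
    by rewrite dstep_ge ?mul0r// lerBrDr ler_pdivlMr//; lra.
have L : `|\int[mu]_(x in `]a, b[) (F x * dl x) - F a| <= eta / 2.
  apply: (Rintegral_kernel_dist ab cF hl).
  - by move=> x; rewrite divr_ge0// ?dstep_ge0// ltW.
  - rewrite subrr mul0r add0r (@step_le (-2)); last lra.
    by rewrite subr0 step_ge// lerBrDr ler_pdivlMr//; lra.
  - by move=> x xab /small dx0; apply: Fa => //; lra.
have Rr : `|\int[mu]_(x in `]a, b[) (F x * dr x) - F b| <= eta / 2.
  apply: (Rintegral_kernel_dist ab cF hr).
  - by move=> x; rewrite divr_ge0// ?dstep_ge0// ltW.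
  - rewrite subrr mul0r add0r (@step_le (-2)); last lra.
    by rewrite oppr0 add0r opprK step_ge// lerBrDr ler_pdivlMr//; lra.
  - by move=> x xab /small dx0; apply: Fb => //; rewrite distrC; lra.
have -> : \int[mu]_(x in `]a, b[) (F x * dcutoff a b h x) =
    \int[mu]_(x in `]a, b[) (F x * dl x) - \int[mu]_(x in `]a, b[) (F x * dr x).
  have iF k : continuous k -> mu.-integrable `]a, b[ (EFin \o (fun x => F x * k x)).
    move=> ck; apply: within_integrable_oo => x; apply: continuousM; first exact: cF.
    exact: within_continuousT.
  rewrite -RintegralB//; [|exact: iF hl.2|exact: iF hr.2].
  by apply: eq_Rintegral => x _; rewrite /dcutoff -mulrBr.
by move: L Rr; rewrite !ler_norml; lra.
Qed.

End boundary_parts.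

Section H1_theory.
Variable R : realType.
Implicit Types (a b e m : R) (f g phi psi dpsi rho : R -> R).
Local Notation mu := (@lebesgue_measure R).

(** The interval is bounded and |g| <= 1 + g^2. *)
Lemma H1_integrable_weak a b phi g : H1 a b phi g ->
  mu.-integrable `]a, b[ (EFin \o g).
Proof.
move=> [_ mg g2 _].
have i1 : mu.-integrable `]a, b[ (EFin \o cst (1 : R)).
  by apply: within_integrable_oo; apply: within_continuousT; exact: cst_continuous.
have : mu.-integrable `]a, b[ (fun x => (1 + g x ^+ 2)%:E).
  exact: integrableD i1 g2.
apply: le_integrable => //; first exact/measurable_EFinP.
move=> x _ /=; rewrite lee_fin (ger0_norm (_ : 0 <= 1 + g x ^+ 2)); last first.
  by rewrite addr_ge0// sqr_ge0.
have := sqr_ge0 (`|g x| - 1).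
rewrite sqrrB1 real_normK ?num_real// mulr2n => h.
have := normr_ge0 (g x); lra.
Qed.

Lemma integrable_mul_within a b f psi : mu.-integrable `]a, b[ (EFin \o f) ->
  {within `[a, b], continuous psi} ->
  mu.-integrable `]a, b[ (EFin \o (fun x => f x * psi x)).
Proof.
move=> fi cpsi.
have := @integrableMl _ _ _ mu `]a, b[ _ (EFin \o f) psi fi.
apply => //.
  apply: (@measurable_funS _ _ _ _ `[a, b]) => //; first exact: subset_itv_oo_cc.
  by apply: subspace_continuous_measurable_fun => //; exact: measurable_itv.
have /compact_bounded[M [Mr hM]] := continuous_compact cpsi (@segment_compact _ a b).
exists M; split => // x Mx y /= yab; apply: hM => //=; exists y => //.
exact: subset_itv_oo_cc.
Qed.

Lemma H1_integrable_mul a b phi g psi : H1 a b phi g ->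
  {within `[a, b], continuous psi} ->
  mu.-integrable `]a, b[ (EFin \o (fun x => g x * psi x)) /\
  mu.-integrable `]a, b[ (EFin \o (fun x => phi x * psi x)).
Proof.
move=> h cpsi; split.
  by apply: integrable_mul_within => //; exact: H1_integrable_weak h.
apply: integrable_mul_within => //.
by case: h => cphi _ _ _; exact: within_integrable_oo.
Qed.

(* Testing against [psi] times a cutoff that tends to 1 on ]a, b[, the derivative
   of the cutoff concentrates at the end points. *)
Lemma H1_parts a b phi g psi dpsi : a < b -> H1 a b phi g -> C1 psi dpsi ->
  \int[mu]_(x in `]a, b[) (g x * psi x + phi x * dpsi x) =
  phi b * psi b - phi a * psi a.
Proof.
move=> ab hphi hpsi; have cpsi := C1_continuous hpsi; case: (hpsi) => _ cdpsi.
case: (hphi) => cphi mg g2 wg.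
pose f x := g x * psi x + phi x * dpsi x.
pose F x := phi x * psi x.
have cF : {within `[a, b], continuous F}.
  by apply: within_continuousM => //; exact: within_continuousT.
have fi : mu.-integrable `]a, b[ (EFin \o f).
  have [i1 _] := H1_integrable_mul hphi (within_continuousT cpsi).
  have [_ i2] := H1_integrable_mul hphi (within_continuousT cdpsi).
  exact: integrableD i1 i2.
pose h n : R := (b - a) / (4 * n.+1%:R).
have h0 n : 0 < h n by rewrite divr_gt0 ?subr_gt0// mulr_gt0.
have hab n : 4 * h n <= b - a.
  rewrite /h invfM !mulrA (mulrC 4) -(mulrA _ 4) divff// mulr1.
  rewrite ler_pdivrMr ?ltr0n//.
  by rewrite ler_peMr ?subr_ge0 ?(ltW ab)// ler1n.
have hcvg : h @ \oo --> 0.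
  have -> : h = fun n => (b - a) / 4 * harmonic n.
    by apply/funext => n; rewrite /h /harmonic /= invfM mulrA.
  by rewrite -[X in _ --> X](mulr0 ((b - a) / 4)); apply: cvgMr; exact: cvg_harmonic.
have key n : \int[mu]_(x in `]a, b[) (f x * cutoff a b (h n) x) =
    - \int[mu]_(x in `]a, b[) (F x * dcutoff a b (h n) x).
  have hc := C1_cutoff a b (h n).
  have cc := C1_continuous hc; case: (hc) => _ cdc.
  have hM := C1M hpsi hc.
  have := wg _ (test_fun_cutoff (h0 n) (hab n) hpsi).
  rewrite (C1_derive hM) => E.
  have [i1 _] := H1_integrable_mul hphi (within_continuousT (C1_continuous hM)).
  have i2 : mu.-integrable `]a, b[ (EFin \o (fun x => F x * dcutoff a b (h n) x)).
    apply: within_integrable_oo; apply: within_continuousM => //.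
    exact: within_continuousT.
  have i3 : mu.-integrable `]a, b[
      (EFin \o (fun x => phi x * (cutoff a b (h n) x * dpsi x))).
    apply: within_integrable_oo; apply: within_continuousM => //.
    by apply: within_continuousT => y; apply: cvgM; [exact: cc|exact: cdpsi].
  have -> : \int[mu]_(x in `]a, b[) (f x * cutoff a b (h n) x) =
     \int[mu]_(x in `]a, b[) (g x * (psi x * cutoff a b (h n) x) +
                              phi x * (cutoff a b (h n) x * dpsi x)).
    by apply: eq_Rintegral => x _; rewrite /f; ring.
  rewrite RintegralD// -[X in X + _]opprK -E.
  have -> : \int[mu]_(x in `]a, b[) (phi x *
      (psi x * dcutoff a b (h n) x + cutoff a b (h n) x * dpsi x)) =
    \int[mu]_(x in `]a, b[) (F x * dcutoff a b (h n) x +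
      phi x * (cutoff a b (h n) x * dpsi x)).
    by apply: eq_Rintegral => x _; rewrite /F; ring.
  by rewrite RintegralD//; ring.
have L1 : (fun n => \int[mu]_(x in `]a, b[) (F x * dcutoff a b (h n) x)) @ \oo -->
    F a - F b.
  apply/cvgrPdist_le => e e0.
  have [d d0 hd] := Rintegral_dcutoff ab cF e0.
  have /cvgrPdist_le /(_ _ d0) := hcvg; apply: filterS => n.
  rewrite sub0r normrN (ger0_norm (ltW (h0 n))) distrC => hnd.
  exact: hd.
have L2 : (fun n => \int[mu]_(x in `]a, b[) (f x * cutoff a b (h n) x)) @ \oo -->
    \int[mu]_(x in `]a, b[) f x.
  have mf := measurable_int _ fi.
  have [|||||| _ _] := @dominated_convergence _ _ R mu `]a, b[ _
      (fun n x => (f x * cutoff a b (h n) x)%:E) (EFin \o f)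
      (fun x => (`|f x|)%:E).
  - by [].
  - move=> n; apply/measurable_EFinP; apply: measurable_funM.
      exact/measurable_EFinP.
    apply: measurable_funTS; apply: continuous_measurable_fun.
    exact: C1_continuous (C1_cutoff _ _ _).
  - exact: mf.
  - apply: aeW => x /=; rewrite in_itv/= => /andP[ax xb].
    apply: cvg_near_cst.
    have d0 : 0 < Num.min (x - a) (b - x) / 3.
      by rewrite divr_gt0// lt_min !subr_gt0 ax.
    have /cvgrPdist_le /(_ _ d0) := hcvg; apply: filterS => n.
    rewrite sub0r normrN (ger0_norm (ltW (h0 n))) ler_pdivlMr// le_min.
    by move=> /andP[? ?]; rewrite cutoff_eq1 ?mulr1//; lra.
  - exact: integrable_norm.
  - apply: aeW => x n _; rewrite /= lee_fin normrM ler_piMr//.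
    exact: cutoff_norm.
  - have fin : (\int[mu]_(x in `]a, b[) (f x)%:E)%E \is a fin_num.
      exact: integrable_fin_num.
    by move=> H; apply: fine_cvg; rewrite /Rintegral fineK//; exact: H.
have L3 : (fun n => \int[mu]_(x in `]a, b[) (f x * cutoff a b (h n) x)) @ \oo -->
    - (F a - F b).
  have -> : (fun n => \int[mu]_(x in `]a, b[) (f x * cutoff a b (h n) x)) =
            (fun n => - \int[mu]_(x in `]a, b[) (F x * dcutoff a b (h n) x)).
    exact/funext.
  exact: cvgN.
rewrite -/f; have := cvg_unique (@Rhausdorff R) L2 L3.
by move=> ->; rewrite opprB.
Qed.

End H1_theory.

(** * Classical solutions minimize the field energy *)

Section field_minimum.
Variable R : realType.
Implicit Types (a b e m : R) (f g phi psi dpsi rho h k : R -> R).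
Local Notation mu := (@lebesgue_measure R).

Lemma inf_minimum (A : set R) x : A x -> (forall y, A y -> x <= y) -> inf A = x.
Proof.
move=> Ax Amin; apply/le_anti/andP; split.
  by apply: ge_inf => //; exists x.
by apply: lb_le_inf => //; exists x.
Qed.

Lemma H1_C1 a b phi dphi : a < b -> C1 phi dphi -> H1 a b phi dphi.
Proof.
move=> ab hphi; have cphi := C1_continuous hphi; case: (hphi) => _ cdphi.
have mdphi : measurable_fun setT dphi by exact: continuous_measurable_fun.
split.
- exact: within_continuousT.
- exact: measurable_funTS.
- apply: within_integrable_oo; apply: within_continuousT => x.
  by apply: cvgM; exact: cdphi.
- move=> psi [dpsi cdpsi _ sub].
  have hpsi : C1 psi (derive1 psi).
    by split => // x; rewrite derive1E; exact/derivableP.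
  have psi0 x : ~ (a < x < b) -> psi x = 0.
    move=> xab; apply/eqP/negP => /negP p0; apply: xab.
    have /sub : closure [set x | psi x != 0] x by exact: subset_closure.
    by rewrite /= in_itv.
  have cpsi := C1_continuous hpsi.
  have := C1_FTC2 ab (C1M hphi hpsi).
  rewrite (psi0 a) ?(psi0 b) ?ltxx ?andbF// !mulr0 subrr RintegralD//.
  + under [X in _ + X = _ -> _]eq_Rintegral do rewrite mulrC.
    by move/eqP; rewrite addr_eq0 => /eqP.
  + apply: within_integrable_oo; apply: within_continuousT => x.
    by apply: cvgM; [exact: cphi|exact: cdpsi].
  + apply: within_integrable_oo; apply: within_continuousT => x.
    by apply: cvgM; [exact: cpsi|exact: cdphi].
Qed.

Lemma field_functional_ext e m rho rho' a b phi g :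
  (forall x, a < x < b -> rho x = rho' x) ->
  field_functional e m rho a b phi g = field_functional e m rho' a b phi g.
Proof.
move=> h; apply: eq_Rintegral => x; rewrite inE/= in_itv/= => xab.
by rewrite h.
Qed.

Lemma periodic_energy_ext e m rho rho' a b :
  (forall x, a < x < b -> rho x = rho' x) ->
  periodic_energy e m rho a b = periodic_energy e m rho' a b.
Proof.
move=> h; rewrite /periodic_energy; congr (- inf _); apply/seteqP; split => J;
  by move=> [phi [g [? ? ->]]]; exists phi, g; split => //;
    apply: field_functional_ext => // x /h.
Qed.

Variables (e m a b : R) (rho phi h k : R -> R).
Hypotheses (ab : a < b) (hphi : C1 phi h) (hh : C1 h k).
Hypothesis rhoE : forall x, rho x = m ^+ 2 * phi x - e ^+ 2 * k x.

Let cphi : continuous phi. Proof. exact: C1_continuous hphi. Qed.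
Let ch : continuous h. Proof. exact: C1_continuous hh. Qed.
Let ck : continuous k. Proof. by case: hh. Qed.
Let crho : continuous rho.
Proof.
rewrite (funext rhoE).
by move=> x; apply: cvgB; apply: cvgM; by [exact: cvg_cst|exact: cphi|exact: ck].
Qed.

Lemma integrable_field_density p g : H1 a b p g -> mu.-integrable `]a, b[
  (EFin \o (fun x => e ^+ 2 / 2 * g x ^+ 2 + m ^+ 2 / 2 * p x ^+ 2 - rho x * p x)).
Proof.
move=> hp; case: (hp) => cp _ g2 _.
have i1 : mu.-integrable `]a, b[ (EFin \o (fun x => e ^+ 2 / 2 * g x ^+ 2)).
  exact: (integrableZl _ (e ^+ 2 / 2) g2).
have i2 : mu.-integrable `]a, b[ (EFin \o (fun x => (m ^+ 2 / 2 * p x) * p x)).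
  apply: within_integrable_oo; apply: within_continuousM => //.
  by apply: within_continuousM => //; by apply: within_continuousT => x; exact: cvg_cst.
have i3 : mu.-integrable `]a, b[ (EFin \o (fun x => rho x * p x)).
  apply: within_integrable_oo; apply: within_continuousM => //.
  exact: within_continuousT.
have i12 : mu.-integrable `]a, b[
    (EFin \o (fun x => e ^+ 2 / 2 * g x ^+ 2 + m ^+ 2 / 2 * p x * p x)).
  exact: integrableD i1 i2.
have : mu.-integrable `]a, b[ (EFin \o
    (fun x => e ^+ 2 / 2 * g x ^+ 2 + m ^+ 2 / 2 * p x * p x - rho x * p x)).
  exact: integrableB i12 i3.
by apply: eq_integrable => // x _; rewrite /= [p x ^+ 2]expr2 mulrA.
Qed.

(** Inserting the equation for [rho], the density becomes - rho phi / 2 plus e^2 / 2 times the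
    derivative of phi h. *)
Lemma field_functional_stationary : field_functional e m rho a b phi h =
  - (2^-1 * \int[mu]_(x in `]a, b[) (rho x * phi x))
  + e ^+ 2 / 2 * (phi b * h b - phi a * h a).
Proof.
have irp : mu.-integrable `]a, b[ (EFin \o (fun x => rho x * phi x)).
  apply: within_integrable_oo; apply: within_continuousT => x.
  by apply: cvgM; [exact: crho|exact: cphi].
have hM := C1M hphi hh.
have iM : mu.-integrable `]a, b[ (EFin \o (fun x => phi x * k x + h x * h x)).
  by apply: within_integrable_oo; apply: within_continuousT; case: hM.
rewrite -(C1_FTC2 ab hM) -mulNr -!RintegralZl//.
rewrite -RintegralD//; [|exact: integrableZl irp|exact: integrableZl iM].
by apply: eq_Rintegral => x _; rewrite rhoE; field.
Qed.

(** Completing the square: the two sides differ by half the integral of e^2 (g - h)^2 + m^2 (p -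
    phi)^2. The boundary term is what remains of the cross term after [H1_parts] with test function
    [h]. *)
Lemma field_functional_ge p g : H1 a b p g ->
  field_functional e m rho a b phi h
  + e ^+ 2 * (h b * (p b - phi b) - h a * (p a - phi a))
  <= field_functional e m rho a b p g.
Proof.
move=> hp; have hp0 := H1_C1 ab hphi.
have [i1 _] := H1_integrable_mul hp (within_continuousT ch).
have [_ i2] := H1_integrable_mul hp (within_continuousT ck).
have [i3 _] := H1_integrable_mul hp0 (within_continuousT ch).
have [_ i4] := H1_integrable_mul hp0 (within_continuousT ck).
have i12 : mu.-integrable `]a, b[ (EFin \o (fun x => g x * h x + p x * k x)).
  exact: integrableD i1 i2.
have i34 : mu.-integrable `]a, b[ (EFin \o (fun x => h x * h x + phi x * k x)).
  exact: integrableD i3 i4.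
have -> : e ^+ 2 * (h b * (p b - phi b) - h a * (p a - phi a)) =
    \int[mu]_(x in `]a, b[)
      (e ^+ 2 * (g x * h x + p x * k x - (h x * h x + phi x * k x))).
  rewrite RintegralZl//; last exact: integrableB i12 i34.
  rewrite RintegralB// (H1_parts ab hp hh) (H1_parts ab hp0 hh); congr (_ * _); ring.
have iZ : mu.-integrable `]a, b[ (EFin \o
    (fun x => e ^+ 2 * (g x * h x + p x * k x - (h x * h x + phi x * k x)))).
  exact: (integrableZl _ (e ^+ 2) (integrableB _ i12 i34)).
rewrite -RintegralD//; last exact: integrable_field_density.
apply: le_Rintegral => //.
- exact: (integrableD _ (integrable_field_density hp0) iZ).
- exact: integrable_field_density.
- move=> x _ /=; rewrite -subr_ge0.
  set d := (X in 0 <= X); have -> : d = 2^-1 * ((e * (g x - h x)) ^+ 2 +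
      (m * (p x - phi x)) ^+ 2) by rewrite /d rhoE; field.
  by rewrite mulr_ge0 ?addr_ge0 ?sqr_ge0// invr_ge0.
Qed.

Lemma periodic_energyE : phi a = phi b -> h a = h b ->
  periodic_energy e m rho a b = 2^-1 * \int[mu]_(x in `]a, b[) (rho x * phi x).
Proof.
move=> pab hab; rewrite -[RHS]opprK; congr (- _); apply: inf_minimum.
  exists phi, h; split => //; first exact: H1_C1.
  by rewrite field_functional_stationary pab hab subrr mulr0 addr0.
move=> _ [p [g [hp ppab ->]]]; apply: le_trans (field_functional_ge hp).
rewrite field_functional_stationary pab hab ppab !subrr !mulr0 !addr0.
by rewrite lexx.
Qed.

(** With zero slope at both ends [phi] minimizes among all of H^1, so the Dirichlet minimum for its
    own traces is the free, Neumann, minimum. *)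
Lemma dirichlet_energyE : h a = 0 -> h b = 0 ->
  dirichlet_energy e m rho a b (phi a) (phi b) =
  2^-1 * \int[mu]_(x in `]a, b[) (rho x * phi x).
Proof.
move=> ha hb; rewrite -[RHS]opprK; congr (- _); apply: inf_minimum.
  exists phi, h; split => //; first exact: H1_C1.
  by rewrite field_functional_stationary ha hb !mulr0 subrr mulr0 addr0.
move=> _ [p [g [hp _ _ ->]]]; apply: le_trans (field_functional_ge hp).
by rewrite field_functional_stationary ha hb !(mul0r, mulr0) subrr !mulr0 !addr0.
Qed.

End field_minimum.

(** * Explicit fields by variation of constants *)

Section field_solution.
Variable R : realType.
Variables (e m : R) (rho U V D : R -> R).
Hypotheses (e0 : 0 < e) (m0 : 0 < m).
Local Notation mu := (@lebesgue_measure R).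
Local Notation lam := (m / e).
Hypothesis hU : C1 U (fun x => expR (- lam * x) * rho x).
Hypothesis hV : C1 V (fun x => expR (lam * x) * rho x).
Hypothesis hD : C1 D (fun x => V x * (expR (- lam * x) * rho x)).
Variables al be : R.

(* Variation of constants for - e^2 phi'' + m^2 phi = rho. *)
Definition field (x : R) : R := (2 * e * m)^-1 *
  ((al - U x) * expR (lam * x) + (be + V x) * expR (- lam * x)).

Definition dfield (x : R) : R := (2 * e ^+ 2)^-1 *
  ((al - U x) * expR (lam * x) - (be + V x) * expR (- lam * x)).

Definition ddfield (x : R) : R := (m ^+ 2 * field x - rho x) / e ^+ 2.

Let expK x : expR (lam * x) * expR (- lam * x) = 1.
Proof. by rewrite -expRD mulNr subrr expR0. Qed.

Let e_neq0 : e != 0. Proof. exact: lt0r_neq0. Qed.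
Let m_neq0 : m != 0. Proof. exact: lt0r_neq0. Qed.

Let hl : C1 (fun x => (al - U x) * expR (lam * x)) _ :=
  C1M (C1B (C1_cst al) hU) (C1_expZ lam).

Let hr : C1 (fun x => (be + V x) * expR (- lam * x)) _ :=
  C1M (C1D (C1_cst be) hV) (C1_expZ (- lam)).

Lemma C1_field : C1 field dfield.
Proof.
have := C1Z (2 * e * m)^-1 (C1D hl hr); apply: C1_ext => // x.
rewrite /dfield !sub0r !add0r.
transitivity ((2 * e * m)^-1 * (lam * ((al - U x) * expR (lam * x) -
  (be + V x) * expR (- lam * x)))); last by field; rewrite e_neq0.
by congr (_ * _); ring.
Qed.

Lemma C1_dfield : C1 dfield ddfield.
Proof.
have := C1Z (2 * e ^+ 2)^-1 (C1B hl hr); apply: C1_ext => // x.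
rewrite /ddfield /field !sub0r !add0r.
transitivity ((2 * e ^+ 2)^-1 * (lam * ((al - U x) * expR (lam * x) +
  (be + V x) * expR (- lam * x)) -
    2 * rho x * (expR (lam * x) * expR (- lam * x)))).
  by congr (_ * _); ring.
by rewrite expK; field; rewrite e_neq0.
Qed.

Lemma field_eqn x : rho x = m ^+ 2 * field x - e ^+ 2 * ddfield x.
Proof. by rewrite /ddfield; field. Qed.

(** Up to the factor 2 e m the integrand is al V' + be U' - U V' + V U', and - U V' + V U' = - (U
    V)' + 2 V U'. The last product is why the third primitive [D], of V U', is needed. *)
Lemma half_Rintegral_field a b : a < b ->
  2^-1 * \int[mu]_(x in `]a, b[) (rho x * field x) =
  (4 * e * m)^-1 * (al * (V b - V a) + be * (U b - U a)
    - (U b * V b - U a * V a) + 2 * (D b - D a)).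
Proof.
move=> ab.
have hP := C1D (C1B (C1D (C1Z al hV) (C1Z be hU)) (C1M hU hV)) (C1Z 2 hD).
have hQ := C1Z (2 * e * m)^-1 hP.
have -> : \int[mu]_(x in `]a, b[) (rho x * field x) =
    \int[mu]_(x in `]a, b[) ((2 * e * m)^-1 *
      (al * (expR (lam * x) * rho x) + be * (expR (- lam * x) * rho x)
       - (U x * (expR (lam * x) * rho x) + V x * (expR (- lam * x) * rho x))
       + 2 * (V x * (expR (- lam * x) * rho x)))).
  by apply: eq_Rintegral => x _; rewrite /field; ring.
by rewrite (C1_FTC2 ab hQ); field; rewrite ?e_neq0 ?m_neq0.
Qed.

End field_solution.

(** * Energies in terms of the primitives of the charge density *)

Section energy_primitives.
Variable R : realType.
Variables (e m : R) (rho U V D : R -> R) (a b : R).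
Hypotheses (e0 : 0 < e) (m0 : 0 < m) (ab : a < b).
Local Notation lam := (m / e).
Hypothesis hU : C1 U (fun x => expR (- lam * x) * rho x).
Hypothesis hV : C1 V (fun x => expR (lam * x) * rho x).
Hypothesis hD : C1 D (fun x => V x * (expR (- lam * x) * rho x)).

Let A := expR (lam * a).
Let B := expR (lam * b).
Let T := expR (- lam * (b - a)).

Let e_neq0 : e != 0. Proof. exact: lt0r_neq0. Qed.
Let m_neq0 : m != 0. Proof. exact: lt0r_neq0. Qed.
Let A0 : 0 < A. Proof. exact: expR_gt0. Qed.
Let B0 : 0 < B. Proof. exact: expR_gt0. Qed.
Let AB : A < B.
Proof. by rewrite ltr_expR ltr_pM2l// divr_gt0. Qed.
Let TE : T = A / B.
Proof. by rewrite /T /A /B -expRN -expRD; congr expR; ring. Qed.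
Let expNa : expR (- lam * a) = A^-1. Proof. by rewrite mulNr expRN. Qed.
Let expNb : expR (- lam * b) = B^-1. Proof. by rewrite mulNr expRN. Qed.
Let A_neq0 : A != 0. Proof. exact: lt0r_neq0. Qed.
Let B_neq0 : B != 0. Proof. exact: lt0r_neq0. Qed.
Let BA_neq0 : B - A != 0. Proof. by rewrite subr_eq0 gt_eqF. Qed.
Let BA2_neq0 : B + A != 0. Proof. by rewrite lt0r_neq0// addr_gt0. Qed.

Lemma periodic_energy_primitives : periodic_energy e m rho a b =
  (2 * e * m)^-1 * (D b - D a - V a * (U b - U a)
    + T * (U b - U a) * (V b - V a) / (1 - T)).
Proof.
(* Periodicity of the field and of its slope decouples into periodicity of the growing and of the
   decaying part, one equation for each constant. *)
pose al := U a + (U b - U a) / (1 - T).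
pose be := T * (V b - V a) / (1 - T) - V a.
have := periodic_energyE ab
  (C1_field e0 m0 hU hV al be) (C1_dfield e0 m0 hU hV al be)
  (@field_eqn R e m rho U V e0 al be).
have T1 : 1 - T != 0.
  rewrite subr_eq0 TE; apply: contra_neq BA_neq0 => h.
  by rewrite -[A](divfK B_neq0) -h mul1r subrr.
rewrite (half_Rintegral_field e0 m0 hU hV hD)// => ->.
- by rewrite /al /be; field; rewrite e_neq0 m_neq0 T1.
- rewrite /field /al /be expNa expNb -/A -/B TE; field.
  by rewrite e_neq0 m_neq0 A_neq0 B_neq0 BA_neq0.
- rewrite /dfield /al /be expNa expNb -/A -/B TE; field.
  by rewrite e_neq0 A_neq0 B_neq0 BA_neq0.
Qed.

(* The Dirichlet data are those of the Neumann problem. *)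
Lemma dirichlet_energy_primitives : U a = 0 -> V a = 0 -> D a = 0 ->
  let s1 := A * U b in let s2 := B^-1 * V b in
  dirichlet_energy e m rho a b
    ((e * m)^-1 * ((s1 + T * s2) / ((1 - T) * (1 + T))))
    ((e * m)^-1 * ((T * s1 + s2) / ((1 - T) * (1 + T)))) =
  (2 * e * m)^-1 * (D b + 2^-1 *
    ((s1 ^+ 2 + s2 ^+ 2 + 2 * T * s1 * s2) / ((1 - T) * (1 + T)))).
Proof.
move=> Ua Va Da s1 s2.
(* Zero slope at [a] forces be = al A^2; zero slope at [b] then determines [al]. *)
pose al := (U b + V b / B ^+ 2) / ((1 - T) * (1 + T)).
pose be := al * A ^+ 2.
have := dirichlet_energyE ab
  (C1_field e0 m0 hU hV al be) (C1_dfield e0 m0 hU hV al be)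
  (@field_eqn R e m rho U V e0 al be).
have fa : field e m U V al be a =
    (e * m)^-1 * ((s1 + T * s2) / ((1 - T) * (1 + T))).
  rewrite /field /be /al /s1 /s2 expNa -/A TE Ua Va; field.
  by rewrite e_neq0 m_neq0 A_neq0 B_neq0 BA_neq0 BA2_neq0.
have fb : field e m U V al be b =
    (e * m)^-1 * ((T * s1 + s2) / ((1 - T) * (1 + T))).
  rewrite /field /be /al /s1 /s2 expNb -/B TE; field.
  by rewrite e_neq0 m_neq0 B_neq0 BA_neq0 BA2_neq0.
rewrite fa fb (half_Rintegral_field e0 m0 hU hV hD)// => ->.
- rewrite /s1 /s2 /be /al Ua Va Da TE; field.
  by rewrite e_neq0 m_neq0 B_neq0 BA_neq0 BA2_neq0.
- rewrite /dfield /be expNa -/A Ua Va; field.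
  by rewrite e_neq0 A_neq0.
- rewrite /dfield /be /al expNb -/B TE; field.
  by rewrite e_neq0 B_neq0 BA_neq0 BA2_neq0.
Qed.

End energy_primitives.

(** * Energies of chains of charges *)

Section charge_primitives.
Variable R : realType.
Implicit Types (c m : R) (f : R -> R).
Local Notation mu := (@lebesgue_measure R).

Lemma Rintegral_eq0 (A : set R) f : (forall x, A x -> f x = 0) ->
  \int[mu]_(x in A) f x = 0.
Proof.
move=> f0; rewrite /Rintegral integral0_eq// => x Ax.
by rewrite f0.
Qed.

Lemma C1_eq_const (a b : R) f df : a <= b -> C1 f df ->
  (forall x, a < x < b -> df x = 0) -> f a = f b.
Proof.
rewrite le_eqVlt => /predU1P[->//|ab] hf df0.
by apply/eqP; rewrite eq_sym -subr_eq0 -(C1_FTC2 ab hf) Rintegral_eq0.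
Qed.

(** The support hypothesis leaves the points c and - c open; they are reached as limits from
    outside, along x + sg / (n + 1). *)
Lemma continuous_support c f : continuous f ->
  (forall x, f x != 0 -> - c <= x <= c) -> forall x, c <= `|x| -> f x = 0.
Proof.
move=> cf f0 x cx.
have out y : c < `|y| -> f y = 0.
  move=> cy; apply/eqP; apply: contraTT cy => /f0.
  by rewrite -ler_norml -leNgt.
have [/out//|xc] := ltP c `|x|; have {}cx : c = `|x| by apply/le_anti/andP.
pose sg : R := if 0 <= x then 1 else -1.
have e n : `|x + sg * harmonic n| = `|x| + harmonic n.
  rewrite /sg; case: (leP 0 x) => x0.
    by rewrite !ger0_norm ?mul1r// addr_ge0// harmonic_ge0.
  by rewrite !ler0_norm ?(ltW x0)// mulN1r ?opprB; [ring|
    rewrite subr_le0 (le_trans (ltW x0))// harmonic_ge0].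
have L : (fun n => x + sg * harmonic n) @ \oo --> x.
  rewrite -[X in _ --> X]addr0 -(mulr0 sg).
  by apply: cvgD; [exact: cvg_cst|apply: cvgMr; exact: cvg_harmonic].
have L1 : (fun n => f (x + sg * harmonic n)) @ \oo --> f x.
  exact: (continuous_cvg _ (cf x) L).
have L2 : (fun n => f (x + sg * harmonic n)) @ \oo --> (0 : R).
  have -> : (fun n => f (x + sg * harmonic n)) = fun=> 0.
    by apply/funext => n; apply: out; rewrite e -cx ltrDl harmonic_gt0.
  exact: cvg_cst.
by apply: (cvg_unique (@Rhausdorff R) L1 L2); exact: fmap_proper_filter.
Qed.

Lemma compact_primitive c f : 0 < c -> continuous f ->
  (forall x, c <= `|x| -> f x = 0) ->
  exists G, [/\ C1 G f, forall x, x <= - c -> G x = 0 &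
               forall x, c <= x -> G x = G c].
Proof.
move=> c0 cf f0.
(* The base point lies strictly left of the support: each x >= - c is then interior to an interval
   of integration, while left of - c the primitive is locally 0. For x < - c - 1 the interval is
   empty, which also gives 0. *)
pose G x := \int[mu]_(t in `[(- c - 1), x]) f t.
have hG : C1 G f.
  split => // x; have [xc|cx] := ltP x (- c).
    rewrite f0; last by rewrite ler0_norm; lra.
    apply: (@near_eq_is_derive _ _ _ (cst 0)).
    near=> y; rewrite /G Rintegral_eq0// => z /=; rewrite in_itv/= => /andP[_ zy].
    have yc : y < - c by near: y; exact: lt_nbhsl.
    have zc := le_lt_trans zy yc.
    by apply: f0; rewrite ler0_norm; lra.
  have [||||dG GE] := @continuous_FTC1_closed R f (- c - 1) x (x + 1).
  - by rewrite ltrDl.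
  - apply: continuous_compact_integrable; first exact: segment_compact.
    exact: within_continuousT.
  - lra.
  - exact: cf.
  - by apply: DeriveDef; [exact: dG|rewrite -derive1E].
exists G; split => //.
- move=> x xc; have : G (x - 2) = 0.
    rewrite /G Rintegral_eq0// => z /=; rewrite in_itv/= => /andP[].
    by move=> h1 h2; move: (le_trans h1 h2); lra.
  move=> <-; apply/esym; apply: (C1_eq_const _ hG) => [|y]; first lra.
  by move=> /andP[_ yx]; apply: f0; rewrite ler0_norm; lra.
- move=> x cx; apply/esym; apply: (C1_eq_const cx hG) => y /andP[cy _].
  by apply: f0; rewrite ger0_norm; lra.
Unshelve. all: by end_near. Qed.

(** [kappa] is the strength of the equivalent point charge, common to the two exponentials; [dinf]
    is the interaction of the charge with itself. *)
Lemma charge_profile_primitives (m vs0 : R) (delta1 : R -> R) : 0 < m -> 0 < vs0 ->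
  charge_profile vs0 delta1 ->
  exists p w d kappa dinf,
    [/\ 0 < kappa,
        [/\ C1 p (fun x => expR (- m * x) * delta1 x),
            C1 w (fun x => expR (m * x) * delta1 x) &
            C1 d (fun x => w x * (expR (- m * x) * delta1 x))],
        forall x, x <= - (vs0 / 2) -> [/\ p x = 0, w x = 0 & d x = 0] &
        forall x, vs0 / 2 <= x -> [/\ p x = kappa, w x = kappa & d x = dinf]].
Proof.
move=> m0 vs0_gt0 [dd d_ge0 d_even d_supp [d_int d1]].
pose c : R := vs0 / 2; rewrite -/c in d_supp *.
have c0 : 0 < c by rewrite divr_gt0.
have cd : continuous delta1.
  move=> x; apply: differentiable_continuous; apply/derivable1_diffP.
  by have := dd 0%N x; rewrite derive1n0.
have d0 := continuous_support cd d_supp.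
have cexp a : continuous (fun x : R => expR (a * x)).
  exact: C1_continuous (C1_expZ a).
have prod (a : R) : continuous (fun x : R => expR (a * x) * delta1 x).
  by move=> x; apply: cvgM; [exact: cexp|exact: cd].
have [p [hp p0 pc]] : exists G, [/\ C1 G (fun x => expR (- m * x) * delta1 x),
    forall x, x <= - c -> G x = 0 & forall x, c <= x -> G x = G c].
  by apply: compact_primitive => // x /d0 ->; rewrite mulr0.
have [w [hw w0 wc]] : exists G, [/\ C1 G (fun x => expR (m * x) * delta1 x),
    forall x, x <= - c -> G x = 0 & forall x, c <= x -> G x = G c].
  by apply: compact_primitive => // x /d0 ->; rewrite mulr0.
have [d [hd dl dr]] : exists G,
    [/\ C1 G (fun x => w x * (expR (- m * x) * delta1 x)),
    forall x, x <= - c -> G x = 0 & forall x, c <= x -> G x = G c].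
  apply: compact_primitive => // [x|x /d0 ->]; last by rewrite !mulr0.
  by apply: cvgM; [exact: (C1_continuous hw)|exact: prod].
have pw : p c = w c.
  (* p(x) + w(- x) is constant because [delta1] is even; comparing its values at - c and c gives p c
     = w c. *)
  have hq := C1D hp (C1_comp hw (C1_affine (-1) 0)).
  have : p (- c) + w (-1 * - c + 0) = p c + w (-1 * c + 0).
    apply: (C1_eq_const _ hq) => [|x _]; first lra.
    have e : -1 * x + 0 = - x by ring.
    by rewrite e d_even (mulrN m) mulNr; ring.
  have -> : -1 * - c + 0 = c by ring.
  have -> : -1 * c + 0 = - c by ring.
  by rewrite (p0 _ (lexx _)) (w0 _ (lexx _)) add0r addr0.
have cc : - c < c by lra.
have k0 : 0 < w c.
  have <- : w c - w (- c) = w c by rewrite (w0 _ (lexx _)) subr0.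
  rewrite -(C1_FTC2 cc hw).
  have dcc : \int[mu]_(x in `](- c), c[) delta1 x = 1.
    rewrite -d1 Rintegral_mkcond; apply: eq_Rintegral => x _.
    rewrite patchE; case: ifPn => //; rewrite notin_setE/= in_itv/= => xc.
    rewrite d0// leNgt; apply: contra_notN xc.
    by rewrite ltr_norml.
  have ci : mu.-integrable `](- c), c[ (EFin \o (fun x => expR (- m * c) * delta1 x)).
    apply: within_integrable_oo; apply: within_continuousT => x.
    by apply: cvgM; [exact: cvg_cst|exact: cd].
  apply: (@lt_le_trans _ _ (\int[mu]_(x in `](- c), c[) (expR (- m * c) * delta1 x))).
    rewrite RintegralZl// ?dcc ?mulr1 ?expR_gt0//.
    exact: (within_integrable_oo (within_continuousT cd)).
  apply: le_Rintegral => //.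
    exact: (within_integrable_oo (within_continuousT (prod _))).
  move=> x /=; rewrite in_itv/= => /andP[cx _].
  by rewrite ler_wpM2r// ler_expR mulNr -mulrN ler_pM2l// ltW.
exists p, w, d, (w c), (d c); split => //.
- by move=> x xc; rewrite p0 ?w0 ?dl.
- by move=> x xc; rewrite pc ?wc ?dr.
Qed.

End charge_primitives.

(** * Finite chains of separated charges *)

Section charge_chain.
Variable R : realType.
Variables (m vs0 e : R) (delta1 p w d : R -> R) (kappa dinf : R).
Hypotheses (m0 : 0 < m) (vs00 : 0 < vs0) (e0 : 0 < e).
Hypothesis supp : forall x, delta1 x != 0 -> - (vs0 / 2) <= x <= vs0 / 2.
Hypothesis hp : C1 p (fun x => expR (- m * x) * delta1 x).
Hypothesis hw : C1 w (fun x => expR (m * x) * delta1 x).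
Hypothesis hd : C1 d (fun x => w x * (expR (- m * x) * delta1 x)).
Hypothesis left0 : forall x, x <= - (vs0 / 2) -> [/\ p x = 0, w x = 0 & d x = 0].
Hypothesis right0 : forall x, vs0 / 2 <= x ->
  [/\ p x = kappa, w x = kappa & d x = dinf].
Variables (Y : nat -> R) (n : nat).
Hypothesis gap : forall i, (i.+1 < n)%N -> e * vs0 <= Y i.+1 - Y i.
Local Notation mu := (@lebesgue_measure R).
Local Notation lam := (m / e).

Definition chain_rho (x : R) : R := \sum_(0 <= i < n) delta1 ((x - Y i) / e).

Definition chain_U (x : R) : R :=
  \sum_(0 <= i < n) (e * expR (- lam * Y i)) * p ((x - Y i) / e).

Definition chain_V (x : R) : R :=
  \sum_(0 <= i < n) (e * expR (lam * Y i)) * w ((x - Y i) / e).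

(** The primitive of V U', charge by charge: the charges left of the k-th act on it as point
    charges, which leaves a multiple of [p], and its action on itself is [d]. *)
Definition chain_D (x : R) : R :=
  \sum_(0 <= k < n) (e ^+ 2 * kappa *
      (\sum_(0 <= i < k) expR (lam * (Y i - Y k))) * p ((x - Y k) / e)
    + e ^+ 2 * d ((x - Y k) / e)).

Let e_neq0 : e != 0. Proof. exact: lt0r_neq0. Qed.

Lemma chain_sep i k : (i < k)%N -> (k < n)%N -> vs0 <= (Y k - Y i) / e.
Proof.
rewrite ler_pdivlMr// mulrC; elim: k => // k ih; rewrite ltnS leq_eqVlt.
move=> /predU1P[-> /gap//|ik kn].
have h1 := gap kn; have h2 := ih ik (ltnW kn).
have : 0 < e * vs0 by rewrite mulr_gt0.
lra.
Qed.

Lemma C1_shift f df y : C1 f df ->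
  C1 (fun x => f ((x - y) / e)) (fun x => df ((x - y) / e) / e).
Proof.
move=> hf; have := C1_comp hf (C1_affine e^-1 (- (y / e))).
have E (x : R) : e^-1 * x + - (y / e) = (x - y) / e by ring.
by apply: C1_ext => x; rewrite E.
Qed.

Let expSP (y x : R) : expR (lam * y) * expR (m * ((x - y) / e)) = expR (lam * x).
Proof. by rewrite -expRD; congr expR; field. Qed.

Let expSN (y x : R) :
  expR (- lam * y) * expR (- m * ((x - y) / e)) = expR (- lam * x).
Proof. by rewrite -expRD; congr expR; field. Qed.

Lemma C1_chain_U : C1 chain_U (fun x => expR (- lam * x) * chain_rho x).
Proof.
have := C1_sum (index_iota 0 n)
  (fun i => C1Z (e * expR (- lam * Y i)) (C1_shift (Y i) hp)).
apply: C1_ext => // x; rewrite /chain_rho mulr_sumr; apply: eq_bigr => i _.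
by rewrite -(expSN (Y i) x); field.
Qed.

Lemma C1_chain_V : C1 chain_V (fun x => expR (lam * x) * chain_rho x).
Proof.
have := C1_sum (index_iota 0 n)
  (fun i => C1Z (e * expR (lam * Y i)) (C1_shift (Y i) hw)).
apply: C1_ext => // x; rewrite /chain_rho mulr_sumr; apply: eq_bigr => i _.
by rewrite -(expSP (Y i) x); field.
Qed.

Let delta_near x k : delta1 ((x - Y k) / e) != 0 ->
  Y k - e * (vs0 / 2) <= x <= Y k + e * (vs0 / 2).
Proof. by move=> /supp; rewrite ler_pdivlMr// ler_pdivrMr//; lra. Qed.

(* On the support of the k-th charge, [w] has saturated for all charges to the
   left and vanishes for those to the right. *)
Let w_delta x k : (k < n)%N ->
  (\sum_(0 <= i < n) expR (lam * Y i) * w ((x - Y i) / e)) * delta1 ((x - Y k) / e) =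
  (kappa * (\sum_(0 <= i < k) expR (lam * Y i))
    + expR (lam * Y k) * w ((x - Y k) / e)) * delta1 ((x - Y k) / e).
Proof.
move=> kn; have [->|/delta_near xk] := eqVneq (delta1 ((x - Y k) / e)) 0.
  by rewrite !mulr0.
congr (_ * _); rewrite (big_cat_nat (leq0n k) (ltnW kn))/=.
rewrite (big_ltn kn) mulr_sumr; congr (_ + _).
  rewrite !big_nat; apply: eq_bigr => i /= ik.
  have [|_ -> _] := @right0 ((x - Y i) / e); last by rewrite mulrC.
  by have := chain_sep ik kn; rewrite !ler_pdivlMr//; lra.
rewrite big_nat big1 ?addr0// => i /andP[ki iN].
have [|_ -> _] := @left0 ((x - Y i) / e); last by rewrite mulr0.
by have := chain_sep ki iN; rewrite ler_pdivlMr// ler_pdivrMr//; lra.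
Qed.

Lemma C1_chain_D : C1 chain_D
  (fun x => chain_V x * (expR (- lam * x) * chain_rho x)).
Proof.
have := C1_sum (index_iota 0 n) (fun k => C1D
  (C1Z (e ^+ 2 * kappa * (\sum_(0 <= i < k) expR (lam * (Y i - Y k))))
       (C1_shift (Y k) hp)) (C1Z (e ^+ 2) (C1_shift (Y k) hd))).
apply: C1_ext => // x; rewrite /chain_rho !mulr_sumr !big_nat.
apply: eq_bigr => k /= kn.
have -> : chain_V x * (expR (- lam * x) * delta1 ((x - Y k) / e)) =
   e * expR (- lam * x) * (\sum_(0 <= i < n) (expR (lam * Y i) * w ((x - Y i) / e)) *
     delta1 ((x - Y k) / e)).
  rewrite -mulr_suml /chain_V.
  under eq_bigr do rewrite -mulrA.
  by rewrite -mulr_sumr; ring.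
rewrite -mulr_suml w_delta//.
rewrite (_ : \sum_(0 <= i < k) expR (lam * (Y i - Y k)) =
  (\sum_(0 <= i < k) expR (lam * Y i)) * expR (- lam * Y k)); last first.
  by rewrite mulr_suml; apply: eq_bigr => i _; rewrite -expRD; congr expR; ring.
rewrite -(expSN (Y k) x).
have E2 : expR (lam * Y k) * expR (- lam * Y k) = 1.
  by rewrite -expRD -mulrDl subrr mul0r expR0.
set a := expR (lam * Y k) in E2 *; set b := expR (- lam * Y k) in E2 *.
set c := expR (- m * _); set S := \sum_(0 <= i < k) _; set de := delta1 _.
set ww := w _.
transitivity (e * (kappa * S * b * c * de + ww * c * de)).
  by field.
by rewrite -[ww * c]mul1r -E2; ring.
Qed.

Let T a b := expR (- lam * (b - a)).
Let S := \sum_(0 <= i < n) expR (- lam * Y i).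
Let Sb := \sum_(0 <= i < n) expR (lam * Y i).
Let P := \sum_(0 <= k < n) \sum_(0 <= i < k) expR (lam * (Y i - Y k)).

Lemma chain_left a : (forall i, (i < n)%N -> a + e * (vs0 / 2) <= Y i) ->
  [/\ chain_U a = 0, chain_V a = 0 & chain_D a = 0].
Proof.
move=> aY; have l i : (i < n)%N -> (a - Y i) / e <= - (vs0 / 2).
  by move=> /aY h; rewrite ler_pdivrMr//; lra.
split; rewrite ?/chain_U ?/chain_V ?/chain_D big_nat big1// => i /andP[_ /l /left0[h1 h2 h3]].
- by rewrite h1 mulr0.
- by rewrite h2 mulr0.
- by rewrite h1 h3 !mulr0 addr0.
Qed.

Lemma chain_right b : (forall i, (i < n)%N -> Y i + e * (vs0 / 2) <= b) ->
  [/\ chain_U b = e * kappa * S, chain_V b = e * kappa * Sb &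
      chain_D b = e ^+ 2 * (n%:R * dinf + kappa ^+ 2 * P)].
Proof.
move=> Yb; have r i : (i < n)%N -> vs0 / 2 <= (b - Y i) / e.
  by move=> /Yb h; rewrite ler_pdivlMr//; lra.
split.
- rewrite /chain_U /S mulr_sumr !big_nat; apply: eq_bigr => i /= /r/right0[-> _ _].
  by rewrite mulrAC.
- rewrite /chain_V /Sb mulr_sumr !big_nat; apply: eq_bigr => i /= /r/right0[_ -> _].
  by rewrite mulrAC.
- transitivity (\sum_(0 <= k < n) (e ^+ 2 * kappa ^+ 2 *
      (\sum_(0 <= i < k) expR (lam * (Y i - Y k))) + e ^+ 2 * dinf)).
    rewrite /chain_D !big_nat; apply: eq_bigr => i /= /r/right0[-> _ ->].
    by congr (_ + _); ring.
  rewrite big_split/= sumr_const_nat subn0 -mulr_sumr -/P -mulr_natl.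
  by ring.
Qed.

Lemma chain_dirichlet_energy a b : a < b ->
  (forall i, (i < n)%N -> a + e * (vs0 / 2) <= Y i) ->
  (forall i, (i < n)%N -> Y i + e * (vs0 / 2) <= b) ->
  let s1 := expR (lam * a) * S in let s2 := expR (- lam * b) * Sb in
  dirichlet_energy e m chain_rho a b
    (kappa / m * ((s1 + T a b * s2) / ((1 - T a b) * (1 + T a b))))
    (kappa / m * ((T a b * s1 + s2) / ((1 - T a b) * (1 + T a b)))) =
  e / (2 * m) * (n%:R * dinf + kappa ^+ 2 * (P + 2^-1 *
    ((s1 ^+ 2 + s2 ^+ 2 + 2 * T a b * s1 * s2) / ((1 - T a b) * (1 + T a b))))).
Proof.
move=> ab /chain_left[Ua Va Da] /chain_right[Ub Vb Db] s1 s2.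
have := dirichlet_energy_primitives e0 m0 ab C1_chain_U C1_chain_V C1_chain_D
  Ua Va Da.
rewrite Ub Vb Db -/(T a b) -expRN -mulNr /=.
have -> : expR (lam * a) * (e * kappa * S) = e * kappa * s1 by rewrite mulrCA.
have -> : expR (- lam * b) * (e * kappa * Sb) = e * kappa * s2 by rewrite mulrCA.
set G := (X in dirichlet_energy _ _ _ _ _ X _).
set H := (X in dirichlet_energy _ _ _ _ _ _ X).
set G' := (X in _ -> dirichlet_energy _ _ _ _ _ X _ = _).
set H' := (X in _ -> dirichlet_energy _ _ _ _ _ _ X = _).
have k1 : (e * m)^-1 * (e * kappa) = kappa / m by field; rewrite e_neq0 lt0r_neq0.
have -> : G = G' by rewrite /G /G' -k1; ring.
have -> : H = H' by rewrite /H /H' -k1; ring.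
move=> ->.
have k2 : (2 * e * m)^-1 * e ^+ 2 = e / (2 * m) by field; rewrite e_neq0 lt0r_neq0.
by rewrite -k2; ring.
Qed.

End charge_chain.

(** * Periodic chains cut at charge centres *)

Section periodic_chain.
Variable R : realType.
Variables (m vs0 e : R) (delta1 p w d : R -> R) (kappa dinf : R).
Hypotheses (m0 : 0 < m) (vs00 : 0 < vs0) (e0 : 0 < e).
Hypothesis supp : forall x, delta1 x != 0 -> - (vs0 / 2) <= x <= vs0 / 2.
Hypothesis hp : C1 p (fun x => expR (- m * x) * delta1 x).
Hypothesis hw : C1 w (fun x => expR (m * x) * delta1 x).
Hypothesis hd : C1 d (fun x => w x * (expR (- m * x) * delta1 x)).
Hypothesis left0 : forall x, x <= - (vs0 / 2) -> [/\ p x = 0, w x = 0 & d x = 0].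
Hypothesis right0 : forall x, vs0 / 2 <= x ->
  [/\ p x = kappa, w x = kappa & d x = dinf].
Variables (Y : nat -> R) (n : nat).
Hypothesis gap : forall i, (i < n)%N -> e * vs0 <= Y i.+1 - Y i.
Hypothesis n0 : (0 < n)%N.
Local Notation lam := (m / e).

Let T := expR (- lam * (Y n - Y 0%N)).
Let S := \sum_(0 <= i < n) expR (- lam * Y i).
Let Sb := \sum_(0 <= i < n) expR (lam * Y i).
Let P := \sum_(0 <= k < n) \sum_(0 <= i < k) expR (lam * (Y i - Y k)).

Let gapS i : (i.+1 < n.+1)%N -> e * vs0 <= Y i.+1 - Y i.
Proof. by rewrite ltnS; exact: gap. Qed.

Let sep := chain_sep vs00 e0 gapS.
Let e_neq0 : e != 0. Proof. exact: lt0r_neq0. Qed.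

Let first k : (0 < k)%N -> (k < n.+1)%N ->
  [/\ p ((Y 0%N - Y k) / e) = 0, w ((Y 0%N - Y k) / e) = 0 &
      d ((Y 0%N - Y k) / e) = 0].
Proof.
move=> k0 kn; apply: left0; have := sep k0 kn.
rewrite !mulrBl; have := vs00; lra.
Qed.

Let last k : (k < n)%N ->
  [/\ p ((Y n - Y k) / e) = kappa, w ((Y n - Y k) / e) = kappa &
      d ((Y n - Y k) / e) = dinf].
Proof.
move=> kn; apply: right0; have := sep kn (ltnSn _).
rewrite !mulrBl; have := vs00; lra.
Qed.

Let big_first (F : nat -> R) : (forall i, (0 < i < n.+1)%N -> F i = 0) ->
  \sum_(0 <= i < n.+1) F i = F 0%N.
Proof. by move=> F0; rewrite big_ltn// big_nat big1 ?addr0. Qed.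

Let yy i : (Y i - Y i) / e = 0. Proof. by rewrite subrr mul0r. Qed.

(** The interval ends at the centres of the charges 0 and n, so it contains half of each. The terms
    in p 0, w 0 and d 0 of the two halves cancel and n whole charges remain. *)
Lemma chain_periodic_energy :
  periodic_energy e m (chain_rho e delta1 Y n.+1) (Y 0%N) (Y n) =
  e / (2 * m) * (n%:R * dinf + kappa ^+ 2 * (P + T * S * Sb / (1 - T))).
Proof.
have ab : Y 0%N < Y n.
  have := sep n0 (ltnSn _); rewrite ler_pdivlMr// => h.
  by rewrite -subr_gt0 (lt_le_trans _ h)// mulr_gt0.
rewrite (periodic_energy_primitives e0 m0 ab (C1_chain_U e0 hp Y n.+1)
  (C1_chain_V e0 hw Y n.+1)
  (C1_chain_D vs00 e0 supp hp hd left0 right0 gapS)).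
have Ua : chain_U m e p Y n.+1 (Y 0%N) = e * expR (- lam * Y 0%N) * p 0.
  rewrite /chain_U big_first ?yy// => i /andP[i0 iN].
  by have [-> _ _] := first i0 iN; rewrite mulr0.
have Va : chain_V m e w Y n.+1 (Y 0%N) = e * expR (lam * Y 0%N) * w 0.
  rewrite /chain_V big_first ?yy// => i /andP[i0 iN].
  by have [_ -> _] := first i0 iN; rewrite mulr0.
have Da : chain_D m e p d kappa Y n.+1 (Y 0%N) = e ^+ 2 * d 0.
  rewrite /chain_D big_first ?yy ?big_geq ?mulr0 ?mul0r ?add0r// => i /andP[i0 iN].
  by have [-> _ ->] := first i0 iN; rewrite !mulr0 addr0.
have Ub : chain_U m e p Y n.+1 (Y n) = e * kappa * S + e * expR (- lam * Y n) * p 0.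
  rewrite /chain_U big_nat_recr//= yy; congr (_ + _).
  rewrite /S mulr_sumr !big_nat; apply: eq_bigr => i /= /last[-> _ _].
  by rewrite mulrAC.
have Vb : chain_V m e w Y n.+1 (Y n) = e * kappa * Sb + e * expR (lam * Y n) * w 0.
  rewrite /chain_V big_nat_recr//= yy; congr (_ + _).
  rewrite /Sb mulr_sumr !big_nat; apply: eq_bigr => i /= /last[_ -> _].
  by rewrite mulrAC.
have Db : chain_D m e p d kappa Y n.+1 (Y n) =
    e ^+ 2 * (n%:R * dinf + kappa ^+ 2 * P) +
    (e ^+ 2 * kappa * (Sb * expR (- lam * Y n)) * p 0 + e ^+ 2 * d 0).
  rewrite /chain_D big_nat_recr//= yy; congr (_ + (_ * _ * _ + _)); last first.
    by rewrite /Sb mulr_suml; apply: eq_bigr => i _; rewrite -expRD; congr expR; ring.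
  transitivity (\sum_(0 <= k < n) (e ^+ 2 * kappa ^+ 2 *
      (\sum_(0 <= i < k) expR (lam * (Y i - Y k))) + e ^+ 2 * dinf)).
    rewrite !big_nat; apply: eq_bigr => i /= /last[-> _ ->].
    by congr (_ + _); ring.
  rewrite big_split/= sumr_const_nat subn0 -mulr_sumr -/P -mulr_natl.
  by ring.
rewrite Ua Va Da Ub Vb Db -/T.
have A0 : expR (lam * Y 0%N) != 0 by rewrite lt0r_neq0// expR_gt0.
have B0 : expR (lam * Y n) != 0 by rewrite lt0r_neq0// expR_gt0.
have AB : expR (lam * Y n) - expR (lam * Y 0%N) != 0.
  by rewrite subr_eq0 gt_eqF// ltr_expR ltr_pM2l// divr_gt0.
have -> : T = expR (lam * Y 0%N) / expR (lam * Y n).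
  by rewrite /T -expRN -expRD; congr expR; ring.
rewrite !mulNr !expRN; set A := expR _ in A0 AB *; set B := expR _ in B0 AB *.
field.
by rewrite A0 B0 AB e_neq0 lt0r_neq0.
Qed.

End periodic_chain.

(** * Interaction sums *)

Section windows.
Variable R : realType.
Implicit Types (r e : int -> R) (j c : int) (k n M : nat) (m s : R).

Definition wsum r j k : R := \sum_(0 <= i < k) r (j + i%:Z).

Definition wexp m r j k : R := expR (- m * wsum r j k).

(* For the bond lengths [r], in units of eps: the interaction energy per period
   [M], truncated to the first [n] shells of neighbours. *)
Definition Phi m M c n r : R :=
  \sum_(0 <= j < M) \sum_(0 <= k < n) wexp m r (c + j%:Z) k.+1.

(* Minus the stress of the bond [j], divided by [m]: the sum over the windows
   containing [j]. *)
Definition sig m n r j : R :=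
  \sum_(0 <= k < n) \sum_(0 <= i < k.+1) wexp m r (j - i%:Z) k.+1.

Lemma wsumS r j k : wsum r j k.+1 = r j + wsum r (j + 1) k.
Proof.
rewrite /wsum big_nat_recl//= addr0; congr (_ + _); apply: eq_bigr => i _.
by congr r; lia.
Qed.

Lemma wsum_ge r j k s : (forall i, s <= r i) -> k%:R * s <= wsum r j k.
Proof.
move=> h; rewrite /wsum mulr_natl -[k in leLHS]subn0 -sumr_const_nat.
by apply: ler_sum_nat.
Qed.

Lemma wexpS m r j k : wexp m r j k.+1 = expR (- m * r j) * wexp m r (j + 1) k.
Proof. by rewrite /wexp wsumS mulrDr expRD. Qed.

Lemma wexp0 m r j : wexp m r j 0 = 1.
Proof. by rewrite /wexp /wsum big_nil mulr0 expR0. Qed.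

Lemma wsum_periodic r (M : int) j k : (forall i, r (i + M) = r i) ->
  wsum r (j + M) k = wsum r j k.
Proof.
move=> h; apply: eq_bigr => i _; rewrite -[in RHS]h; congr r; lia.
Qed.

Lemma wexp_periodic m r (M : int) j k : (forall i, r (i + M) = r i) ->
  wexp m r (j + M) k = wexp m r j k.
Proof. by move=> h; rewrite /wexp wsum_periodic. Qed.

Lemma sum_period_succ (F : int -> R) M c : (forall j, F (j + M%:Z) = F j) ->
  \sum_(0 <= i < M) F (c + 1 + i%:Z) = \sum_(0 <= i < M) F (c + i%:Z).
Proof.
case: M => [|M] h; first by rewrite !big_nil.
rewrite big_nat_recr//= [RHS]big_nat_recl//= addrC addr0; congr (_ + _).
  by rewrite -[RHS]h; congr F; lia.
by apply: eq_bigr => i _; congr F; lia.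
Qed.

Lemma sum_period_shift (F : int -> R) M c c' : (forall j, F (j + M%:Z) = F j) ->
  \sum_(0 <= i < M) F (c + i%:Z) = \sum_(0 <= i < M) F (c' + i%:Z).
Proof.
move=> h; wlog cc' : c c' / c <= c' => [H|].
  by case: (leP c c') => [/H//|/ltW/H].
have [k ->] : exists k : nat, c' = c + k%:Z by exists `|c' - c|%N; lia.
elim: k => [|k ->]; first by rewrite addr0.
by rewrite -sum_period_succ//; apply: eq_bigr => i _; congr F; lia.
Qed.

(* Windows are sorted by the position of [j] inside them. *)
Lemma sum_wsum_sig m M c n r e : (forall j, r (j + M%:Z) = r j) ->
  (forall j, e (j + M%:Z) = e j) ->
  \sum_(0 <= j < M) \sum_(0 <= k < n)
     (wsum e (c + j%:Z) k.+1 * wexp m r (c + j%:Z) k.+1) =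
  \sum_(0 <= j < M) e (c + j%:Z) * sig m n r (c + j%:Z).
Proof.
move=> hr he; rewrite exchange_big_nat/=.
under [RHS]eq_bigr do rewrite mulr_sumr.
rewrite [RHS]exchange_big_nat/=; apply: eq_bigr => k _.
under eq_bigr do rewrite /wsum mulr_suml.
under [RHS]eq_bigr do rewrite mulr_sumr.
rewrite exchange_big_nat [RHS]exchange_big_nat/=; apply: eq_bigr => i _.
pose F j := e j * wexp m r (j - i%:Z) k.+1.
have hF j : F (j + M%:Z) = F j.
  rewrite /F he -(wexp_periodic m (j - i%:Z) k.+1 hr).
  by rewrite (_ : j + M%:Z - i%:Z = j - i%:Z + M%:Z) //; lia.
rewrite -/(\sum_(0 <= j < M) F (c + j%:Z)) (sum_period_shift c (c + i%:Z) hF).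
apply: eq_bigr => j _; rewrite /F.
rewrite (_ : c + i%:Z + j%:Z = c + j%:Z + i%:Z); last by rewrite addrAC.
by rewrite addrK.
Qed.

Lemma wsum_shift r (t : R) e j k :
  wsum (fun i => r i + t * e i) j k = wsum r j k + t * wsum e j k.
Proof. by rewrite /wsum big_split/= mulr_sumr. Qed.

Lemma sum_triangle n (F : nat -> nat -> R) :
  \sum_(0 <= i < n) \sum_(i.+1 <= k < n) F i k =
  \sum_(0 <= k < n) \sum_(0 <= i < k) F i k.
Proof.
elim: n => [|n ih]; first by rewrite !big_nil.
rewrite big_nat_recr//= [in RHS]big_nat_recr//= (big_geq (leqnn n.+1)) addr0.
rewrite -ih -big_split/= !big_nat.
by apply: eq_bigr => i /= iN; rewrite big_nat_recr.
Qed.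

(** A contraction argument replaces the rearrangement of a double series. The sums [A i n] over
    windows starting at bond i satisfy A i (n + 1) = exp(- m r_i) (1 + A (i + 1) n) with cyclic i,
    and [B] solves the fixed-point equation, so the error shrinks by [q] with each shell. *)
Lemma Phi_cvg m s M c r (Z : nat -> R) : 0 < m -> 0 < s -> (0 < M)%N ->
  (forall j, r (j + M%:Z) = r j) -> (forall j, s <= r j) ->
  (forall i, (i < M)%N -> Z i.+1 - Z i = m * r (c + i%:Z)) ->
  let T := expR (- (Z M - Z 0%N)) in
  (fun n => Phi m M c n r) @ \oo -->
  \sum_(0 <= k < M) \sum_(0 <= i < k) expR (Z i - Z k) +
  T * (\sum_(0 <= i < M) expR (- Z i)) * (\sum_(0 <= i < M) expR (Z i)) / (1 - T).
Proof.
move=> m0 s0 M0 rM rs hZ T.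
pose q := expR (- m * s).
have q1 : q < 1 by rewrite expR_lt1 mulNr oppr_lt0 mulr_gt0.
have q0 : 0 < q := expR_gt0 _.
pose S := \sum_(0 <= i < M) expR (- Z i).
pose A i n := \sum_(0 <= k < n) wexp m r (c + i%:Z) k.+1.
(* Windows ending within the current period, then those ending in later periods, where each further
   period contributes a factor T. *)
pose B i := \sum_(i.+1 <= k < M) expR (Z i - Z k) + expR (Z i) * (T * S / (1 - T)).
have S0 : 0 <= S by apply: sumr_ge0 => i _; exact: expR_ge0.
have T1 : T < 1.
  rewrite expR_lt1 oppr_lt0 subr_gt0.
  have mono i : (0 < i)%N -> (i <= M)%N -> Z 0%N < Z i.
    elim: i => // i ih _ iM; have := hZ i iM; have := mulr_gt0 m0 (lt_le_trans s0 (rs (c + i%:Z))).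
    case: (posnP i) => [->|i0]; first lra.
    by have := ih i0 (ltnW iM); lra.
  exact: mono.
have T0 : 0 < T := expR_gt0 _.
have B0 i : 0 <= B i.
  rewrite addr_ge0//; first by apply: sumr_ge0 => k _; exact: expR_ge0.
  by rewrite mulr_ge0 ?expR_ge0// divr_ge0 ?mulr_ge0 ?(ltW T0)// subr_ge0 ltW.
have AS i n : A i n.+1 = expR (- m * r (c + i%:Z)) * (1 + A i.+1 n).
  rewrite /A big_nat_recl//= wexpS wexp0 mulr1 mulrDr mulr1; congr (_ + _).
  rewrite mulr_sumr; apply: eq_bigr => k _; rewrite wexpS.
  by rewrite (_ : c + i%:Z + 1 = c + i.+1%:Z)//; lia.
have AM n : A M n = A 0%N n.
  apply: eq_bigr => k _; rewrite -(wexp_periodic m (c + 0%:Z) k.+1 rM).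
  by rewrite addr0.
have BS i : (i.+1 < M)%N -> B i = expR (- m * r (c + i%:Z)) * (1 + B i.+1).
  move=> iM; have -> : - m * r (c + i%:Z) = Z i - Z i.+1.
    by have := hZ i (ltnW iM); lra.
  rewrite /B (big_ltn iM) mulrDr mulr1 mulrDr -addrA; congr (_ + (_ + _)).
    by rewrite mulr_sumr; apply: eq_bigr => k _; rewrite -expRD; congr expR; ring.
  by rewrite [RHS]mulrA -expRD; congr (expR _ * _); ring.
have BM : B M.-1 = expR (- m * r (c + M.-1%:Z)) * (1 + B 0%N).
  have M1 : (M.-1 < M)%N by rewrite prednK.
  have -> : - m * r (c + M.-1%:Z) = Z M.-1 - Z M.
    by have := hZ _ M1; rewrite prednK//; lra.
  have -> : 1 + B 0%N = expR (Z 0%N) * S / (1 - T).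
    have -> : 1 + B 0%N = expR (Z 0%N) * S + expR (Z 0%N) * (T * S / (1 - T)).
      rewrite /B addrA; congr (_ + _).
      rewrite /S (big_ltn M0) mulrDr -expRD subrr expR0; congr (_ + _).
      by rewrite mulr_sumr; apply: eq_bigr => k _; rewrite -expRD.
    by field; rewrite subr_eq0 gt_eqF.
  rewrite /B prednK// big_geq// add0r.
  have -> : T = expR (Z 0%N) * expR (- Z M) by rewrite /T -expRD; congr expR; ring.
  by rewrite expRD; ring.
pose C := \sum_(0 <= i < M) B i.
have BC i : (i < M)%N -> B i <= C.
  move=> iM; rewrite /C (bigD1_seq i) ?mem_index_iota ?iota_uniq//=.
  by rewrite lerDl; apply: sumr_ge0.
have C0 : 0 <= C by apply: sumr_ge0.
have err n : forall i, (i < M)%N -> `|B i - A i n| <= C * q ^+ n.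
  elim: n => [|n ih] i iM.
    by rewrite /A big_nil subr0 expr0 mulr1 ger0_norm// BC.
  have le_q : expR (- m * r (c + i%:Z)) <= q.
    by rewrite ler_expR !mulNr lerN2 ler_pM2l.
  have [i1 [i1M ->]] : exists i1, (i1 < M)%N /\
      B i - A i n.+1 = expR (- m * r (c + i%:Z)) * (B i1 - A i1 n).
    have [iM1|] := ltnP i.+1 M.
      by exists i.+1; split => //; rewrite AS (BS _ iM1); ring.
    move=> Mi; have ? : i = M.-1 by lia.
    subst i; exists 0%N; split => //; rewrite AS BM prednK// AM; ring.
  rewrite normrM ger0_norm ?expR_ge0// exprS mulrCA.
  by apply: ler_pM => //; rewrite ?expR_ge0// ih.
have -> : \sum_(0 <= k < M) \sum_(0 <= i < k) expR (Z i - Z k) +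
   T * S * (\sum_(0 <= i < M) expR (Z i)) / (1 - T) = C.
  rewrite /C /B big_split/= -mulr_suml -sum_triangle; congr (_ + _); ring.
have cvgq : (fun n => M%:R * C * q ^+ n) @ \oo --> (0 : R).
  rewrite -(mulr0 (M%:R * C)); apply: cvgMr; apply: cvg_expr.
  by rewrite ger0_norm ?(ltW q0).
apply/cvgrPdist_le => e0 e00.
have /cvgrPdist_le /(_ _ e00) := cvgq; apply: filterS => n.
rewrite sub0r normrN ger0_norm; last first.
  by rewrite !mulr_ge0// exprn_ge0// ltW.
apply: le_trans; rewrite {1}/C /Phi -/(\sum_(0 <= i < M) A i n) -sumrB.
apply: (le_trans (ler_norm_sum _ _ _)).
rewrite -[M in leRHS]subn0 -mulrA mulr_natl -sumr_const_nat.
by apply: ler_sum_nat => i /andP[_ iM]; exact: err.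
Qed.

End windows.

(** * Mirror images of a chain *)

Section reflection.
Variable R : realType.

Lemma sum_offset n p (F : nat -> R) :
  \sum_(n <= i < n + p) F i = \sum_(0 <= i < p) F (n + i)%N.
Proof.
rewrite -{1}[n]add0n big_addn addKn; apply: eq_bigr => i _; by rewrite addnC.
Qed.

Lemma sum_reflect n (X : nat -> R) b (f : R -> R) (Z : nat -> R) :
  (forall i, (i < n)%N -> Z i = X i) ->
  (forall i, (i < n)%N -> Z (n + i)%N = 2 * b - X (n.-1 - i)%N) ->
  \sum_(0 <= i < n + n) f (Z i) =
  \sum_(0 <= i < n) f (X i) + \sum_(0 <= i < n) f (2 * b - X i).
Proof.
move=> hl hr; rewrite (@big_cat_nat _ _ _ n)//= ?leq_addr//; congr (_ + _).
  by rewrite !big_nat; apply: eq_bigr => i /hl ->.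
rewrite (sum_offset n) [RHS]big_nat_rev/= add0n !big_nat.
apply: eq_bigr => i /= iN; rewrite hr//; congr (f (_ - X _)); lia.
Qed.

(* The interaction of a chain with its mirror images in [a] and [b]. *)
Lemma reflected_chain_sum n (X Z : nat -> R) a b : a < b ->
  (forall i, (i < n)%N -> Z i = X i) ->
  (forall i, (i < n)%N -> Z (n + i)%N = 2 * b - X (n.-1 - i)%N) ->
  let t := expR (- (b - a)) in
  let s1 := expR a * \sum_(0 <= i < n) expR (- X i) in
  let s2 := expR (- b) * \sum_(0 <= i < n) expR (X i) in
  let T := expR (- (2 * (b - a))) in
  \sum_(0 <= k < n + n) \sum_(0 <= i < k) expR (Z i - Z k) +
  T * (\sum_(0 <= i < n + n) expR (- Z i)) * (\sum_(0 <= i < n + n) expR (Z i)) / (1 - T)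
  = 2 * (\sum_(0 <= k < n) \sum_(0 <= i < k) expR (X i - X k) +
     2^-1 * ((s1 ^+ 2 + s2 ^+ 2 + 2 * t * s1 * s2) / ((1 - t) * (1 + t)))).
Proof.
move=> ab hl hr t s1 s2 T.
rewrite (sum_reflect (fun x => expR (- x)) hl hr) (sum_reflect expR hl hr).
set S := \sum_(0 <= i < n) expR (- X i) in s1 *.
set Sb := \sum_(0 <= i < n) expR (X i) in s2 *.
have -> : \sum_(0 <= i < n) expR (- (2 * b - X i)) = expR (- b) ^+ 2 * Sb.
  by rewrite mulr_sumr; apply: eq_bigr => i _; rewrite -expRM_natl -expRD; congr expR; ring.
have -> : \sum_(0 <= i < n) expR (2 * b - X i) = expR b ^+ 2 * S.
  by rewrite mulr_sumr; apply: eq_bigr => i _; rewrite -expRM_natl -expRD; congr expR; ring.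
(* Pairs inside the chain and pairs inside its image contribute equally; the mixed pairs factor into
   a square. *)
have -> : \sum_(0 <= k < n + n) \sum_(0 <= i < k) expR (Z i - Z k) =
   2 * (\sum_(0 <= k < n) \sum_(0 <= i < k) expR (X i - X k)) +
   expR (- b) ^+ 2 * Sb ^+ 2.
  rewrite (@big_cat_nat _ _ _ n)//= ?leq_addr//.
  rewrite -[X in _ + X = _](_ : \sum_(0 <= k < n) \sum_(0 <= i < k) expR (X i - X k) +
     expR (- b) ^+ 2 * Sb ^+ 2 = _); last first.
    rewrite (sum_offset n).
    under [RHS]eq_bigr => k _ do rewrite (big_cat_nat (leq0n n) (leq_addr k n)).
    rewrite big_split [LHS]addrC; congr (_ + _).
      rewrite expr2 mulrA mulr_sumr [RHS]big_nat_rev/= add0n !big_nat.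
      apply: eq_bigr => k /= kn; rewrite -mulrA (mulrC Sb) mulrA mulr_sumr !big_nat.
      apply: eq_bigr => i /= iN; rewrite (hl i)// hr; last lia.
      rewrite -!expRD; congr expR.
      by rewrite (_ : (n.-1 - (n - k.+1))%N = k); [ring|lia].
    rewrite -sum_triangle [RHS]big_nat_rev/= add0n !big_nat.
    apply: eq_bigr => k /= kn.
    rewrite (sum_offset n) -{1}(_ : (k.+1 + (n - k.+1))%N = n); last lia.
    rewrite (sum_offset k.+1) [RHS]big_nat_rev/= add0n !big_nat.
    apply: eq_bigr => i /= iN; rewrite !hr; [|lia|lia].
    congr expR; rewrite (_ : (n.-1 - (n - k.+1))%N = k); last lia.
    rewrite (_ : (n.-1 - (n - k.+1 - i.+1))%N = (k.+1 + i)%N); [ring|lia].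
  rewrite !big_nat [in LHS](eq_bigr (fun k => \sum_(0 <= i < k) expR (X i - X k))).
    by rewrite -!big_nat; ring.
  move=> k /= kn; rewrite !big_nat; apply: eq_bigr => i /= ik.
  by rewrite !hl//; lia.
have -> : T = (expR a / expR b) ^+ 2.
  by rewrite /T -expRN -expRD -expRM_natl; congr expR; ring.
have -> : t = expR a / expR b by rewrite /t -expRN -expRD; congr expR; ring.
rewrite /s1 /s2 expRN; set A := expR a; set B := expR b.
have A0 : A != 0 by rewrite lt0r_neq0// expR_gt0.
have B0 : B != 0 by rewrite lt0r_neq0// expR_gt0.
have BA : B - A != 0 by rewrite subr_eq0 gt_eqF// ltr_expR.
have BA2 : B + A != 0 by rewrite lt0r_neq0// addr_gt0 ?expR_gt0.
have BA3 : B ^+ 2 - A ^+ 2 != 0 by rewrite subr_sqr mulf_neq0.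
field.
by rewrite BA BA2 B0 BA3.
Qed.

End reflection.

(** * Convexity of the interaction sum by finite differences *)

Section finite_differences.
Variable R : realType.
Implicit Types (r e : int -> R) (j c : int) (k n M : nat) (m s t x z : R).

Lemma exp_tangent x z : z * expR x <= expR (x + z) - expR x.
Proof.
rewrite expRD -[X in _ <= _ - X]mulr1 -mulrBr mulrC ler_pM2l ?expR_gt0//.
by have := expR_ge1Dx z; lra.
Qed.

(** The tangent at x + z gives the bound z exp(x + z), which exceeds z exp(x) by at most z^2
    exp(u). *)
Lemma exp_tangent_le x z u : x <= u -> x + z <= u ->
  expR (x + z) - expR x <= z * expR x + z ^+ 2 * expR u.
Proof.
move=> xu xzu.
have h1 := exp_tangent x z; have := exp_tangent (x + z) (- z).
rewrite addrK => h2.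
have e1 : expR x <= expR u by rewrite ler_expR.
have e2 : expR (x + z) <= expR u by rewrite ler_expR.
have := expR_gt0 x; have := expR_gt0 (x + z).
move: (expR x) (expR (x + z)) (expR u) h1 h2 e1 e2 => a b d h1 h2 e1 e2 b0 a0.
by case: (leP 0 z) => z0; nra.
Qed.

Lemma exp_dist x y u : x <= u -> y <= u ->
  `|expR x - expR y| <= `|x - y| * expR u.
Proof.
wlog xy : x y / x <= y => [H xu yu|xu yu].
  case: (leP x y) => [xy|/ltW yx]; first exact: H.
  by rewrite distrC (distrC x); exact: H.
have h := exp_tangent y (x - y); rewrite subrKC in h.
rewrite ler0_norm ?subr_le0 ?ler_expR// ler0_norm ?subr_le0//.
have e2 : expR y <= expR u by rewrite ler_expR.
have : (y - x) * expR y <= (y - x) * expR u by rewrite ler_wpM2l ?subr_ge0.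
lra.
Qed.

(* The right-hand side is exp(x) (exp(t z) - 1) (exp((1 - t) z) - 1). *)
Lemma exp_four_points x z t u : 0 <= t <= 1 -> u <= x -> u <= x + z ->
  t * (1 - t) * z ^+ 2 * expR u <=
  expR (x + z) - expR (x + (1 - t) * z) - expR (x + t * z) + expR x.
Proof.
move=> t01; wlog z0 : x z / 0 <= z => [H ux uxz|ux uxz].
  have [z0|z0] := leP 0 z; first exact: H.
  have := H (x + z) (- z); rewrite sqrrN addrK => /(_ _ uxz ux).
  rewrite (_ : x + z + (1 - t) * - z = x + t * z); last ring.
  rewrite (_ : x + z + t * - z = x + (1 - t) * z); last ring.
  move=> h; have := h _; rewrite oppr_ge0 (ltW z0) => /(_ isT); lra.
have -> : expR (x + z) - expR (x + (1 - t) * z) - expR (x + t * z) + expR x =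
    expR x * ((expR (t * z) - 1) * (expR ((1 - t) * z) - 1)).
  have -> : x + z = x + (t * z + (1 - t) * z) by ring.
  by rewrite !expRD; ring.
have h1 := expR_ge1Dx (t * z); have h2 := expR_ge1Dx ((1 - t) * z).
rewrite mulrC; apply: ler_pM.
- exact: expR_ge0.
- by rewrite mulr_ge0 ?sqr_ge0// mulr_ge0//; lra.
- by rewrite ler_expR.
- rewrite (_ : t * (1 - t) * z ^+ 2 = (t * z) * ((1 - t) * z)); last ring.
  apply: ler_pM; [| |lra|lra]; by rewrite mulr_ge0//; lra.
Qed.

Lemma wexp_shift m r t e j k : wexp m (fun i => r i + t * e i) j k =
  expR (- m * wsum r j k + t * (- m * wsum e j k)).
Proof. by rewrite /wexp wsum_shift; congr expR; ring. Qed.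

Lemma Phi_tangent m M c n r e t : (forall j, r (j + M%:Z) = r j) ->
  (forall j, e (j + M%:Z) = e j) ->
  - (t * m) * \sum_(0 <= j < M) e (c + j%:Z) * sig m n r (c + j%:Z) <=
  Phi m M c n (fun i => r i + t * e i) - Phi m M c n r.
Proof.
move=> hr he; rewrite -(sum_wsum_sig m c n hr he) /Phi -sumrB mulr_sumr.
apply: ler_sum => j _; rewrite -sumrB mulr_sumr; apply: ler_sum => k _.
rewrite wexp_shift; apply: le_trans (exp_tangent _ _).
by rewrite /wexp le_eqVlt; apply/orP; left; apply/eqP; ring.
Qed.

(** [n.+1] keeps the shell of single bonds. Only that shell yields the quadratic term; in the longer
    windows the increments may cancel, and their contribution is merely nonnegative. *)
Lemma Phi_four_points m M c n r e t S0 : 0 < m -> 0 <= t <= 1 ->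
  (forall j, r j <= S0) -> (forall j, r j + e j <= S0) ->
  t * (1 - t) * (m ^+ 2 * expR (- m * S0)) *
    (\sum_(0 <= j < M) e (c + j%:Z) ^+ 2) <=
  Phi m M c n.+1 (fun i => r i + e i) - Phi m M c n.+1 (fun i => r i + (1 - t) * e i)
  - Phi m M c n.+1 (fun i => r i + t * e i) + Phi m M c n.+1 r.
Proof.
move=> m0 t01 rS reS; rewrite /Phi -!sumrB -big_split/= mulr_sumr.
apply: ler_sum => j _; rewrite -!sumrB -big_split/= big_nat_recl//=.
have e1 : (fun i => r i + e i) = (fun i => r i + 1 * e i).
  by apply/funext => i; rewrite mul1r.
have w1 f : wsum f (c + j%:Z) 1 = f (c + j%:Z).
  by rewrite wsumS /wsum big_nil addr0.
rewrite -[leLHS]addr0; apply: lerD.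
  rewrite {1}e1 !wexp_shift mul1r /wexp !w1.
  have h (u : R) : u <= S0 -> - m * S0 <= - m * u.
    by move=> uS; rewrite !mulNr lerN2 ler_pM2l.
  apply: le_trans (@exp_four_points _ _ t (- m * S0) t01 (h _ (rS (c + j%:Z))) _).
    by rewrite le_eqVlt; apply/orP; left; apply/eqP; ring.
  by rewrite -mulrDr; exact: h.
apply: sumr_ge0 => k _; rewrite e1 !wexp_shift mul1r /wexp.
set x := - m * wsum r _ _; set z := - m * wsum e _ _.
have := @exp_four_points x z t (Num.min x (x + z)) t01.
rewrite ge_min lexx ge_min lexx orbT => /(_ isT isT); apply: le_trans.
rewrite mulr_ge0 ?expR_ge0// mulr_ge0 ?sqr_ge0// mulr_ge0//; lra.
Qed.

Lemma wsum_norm_le e j k S : (forall i, `|e i| <= S) -> `|wsum e j k| <= k%:R * S.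
Proof.
move=> h; apply: (le_trans (ler_norm_sum _ _ _)).
rewrite mulr_natl -[k in leRHS]subn0 -sumr_const_nat; exact: ler_sum.
Qed.

(** The remainder may grow with the period and with S, as it vanishes with t; what matters is that
    the sum over k is bounded uniformly in n. *)
Lemma Phi_tangent_le m M c n r e t s S : 0 < m ->
  (forall j, r (j + M%:Z) = r j) -> (forall j, e (j + M%:Z) = e j) ->
  (forall j, s <= r j) -> (forall j, s <= r j + t * e j) ->
  (forall j, `|e j| <= S) ->
  Phi m M c n (fun i => r i + t * e i) - Phi m M c n r <=
  - (t * m) * \sum_(0 <= j < M) e (c + j%:Z) * sig m n r (c + j%:Z) +
  t ^+ 2 * (M%:R * (m * S) ^+ 2 *
    \sum_(0 <= k < n) k.+1%:R ^+ 2 * expR (- m * s) ^+ k.+1).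
Proof.
move=> m0 hr he rs res eS.
rewrite -(sum_wsum_sig m c n hr he) /Phi -sumrB [- (t * m) * _]mulr_sumr.
set Q := \sum_(0 <= k < n) k.+1%:R ^+ 2 * expR (- m * s) ^+ k.+1.
have -> : M%:R * (m * S) ^+ 2 * Q = \sum_(0 <= j < M) ((m * S) ^+ 2 * Q).
  by rewrite sumr_const_nat subn0 -[RHS]mulr_natl mulrA.
rewrite [t ^+ 2 * _]mulr_sumr -big_split/=.
apply: ler_sum => j _; rewrite -sumrB /Q !mulr_sumr -big_split/=; apply: ler_sum => k _.
rewrite wexp_shift.
set x := - m * wsum r _ _; set z := t * (- m * wsum e _ _).
have q k' r' : (forall i, s <= r' i) ->
    - m * wsum r' (c + j%:Z) k' <= - m * (k'%:R * s).
  by move=> h; rewrite !mulNr lerN2 ler_pM2l//; exact: wsum_ge.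
have xu : x <= - m * (k.+1%:R * s) by exact: q.
have xzu : x + z <= - m * (k.+1%:R * s).
  by have := q k.+1 _ res; rewrite wsum_shift; apply: le_trans; rewrite /x /z; lra.
apply: (le_trans (exp_tangent_le xu xzu)); apply: lerD.
  by rewrite /wexp /x /z le_eqVlt; apply/orP; left; apply/eqP; ring.
have -> : - m * (k.+1%:R * s) = k.+1%:R * (- m * s) by ring.
rewrite expRM_natl /z exprMn -mulrA ler_wpM2l ?sqr_ge0//.
rewrite mulrA ler_wpM2r ?exprn_ge0 ?expR_ge0//.
rewrite -[leLHS]real_normK ?num_real// -exprMn.
rewrite normrM normrN (gtr0_norm m0) -mulrA.
rewrite ler_pXn2r ?nnegrE ?mulr_ge0 ?(ltW m0)//.
  by rewrite ler_pM2l// mulrC; exact: wsum_norm_le.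
by have := eS c; apply: le_trans.
Qed.

(** Of the four factors exp(- x), three absorb the cube through k exp(- k x) <= 1 / x and the fourth
    is summed. *)
Lemma poly_geometric_bound x : 0 < x -> exists2 C, 0 < C & forall n,
  \sum_(0 <= k < n) k.+1%:R ^+ 3 * expR (- (4 * x)) ^+ k.+1 <= C.
Proof.
move=> x0; pose q := expR (- x).
have q1 : q < 1 by rewrite expR_lt1 oppr_lt0.
have q0 : 0 < q := expR_gt0 _.
have C0 : 0 < x ^- 3 / (1 - q) by rewrite divr_gt0 ?invr_gt0 ?exprn_gt0 ?subr_gt0.
exists (x ^- 3 / (1 - q)) => // n.
have le1 k : k.+1%:R ^+ 3 * expR (- (4 * x)) ^+ k.+1 <= x ^- 3 * q ^+ k.
  have -> : expR (- (4 * x)) = q ^+ 3 * q.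
    by rewrite -exprSr -expRM_natl; congr expR; ring.
  have -> : k.+1%:R ^+ 3 * (q ^+ 3 * q) ^+ k.+1 =
      (k.+1%:R * q ^+ k.+1) ^+ 3 * q ^+ k.+1.
    by rewrite exprMn -exprM mulnC exprM exprMn mulrA.
  have Q0 i : 0 <= q ^+ i by rewrite exprn_ge0// ltW.
  apply: ler_pM => //; first by rewrite exprn_ge0// mulr_ge0.
    rewrite -exprVn lerXn2r ?nnegrE ?mulr_ge0// ?invr_ge0 ?(ltW x0)//.
    rewrite -expRM_natl mulrN expRN ler_pdivrMr ?expR_gt0// ler_pdivlMl//.
    by have := expR_ge1Dx (k.+1%:R * x); lra.
  by rewrite exprS ler_piMl// ltW.
apply: (le_trans (ler_sum _ (fun k _ => le1 k))).
rewrite -mulr_sumr ler_pM2l ?invr_gt0 ?exprn_gt0//.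
rewrite -[leRHS]mul1r ler_pdivlMr ?subr_gt0//.
have -> : (\sum_(0 <= k < n) q ^+ k) * (1 - q) = 1 - q ^+ n.
  elim: n => [|n ih]; first by rewrite big_nil mul0r expr0 subrr.
  by rewrite big_nat_recr//= mulrDl ih exprSr; ring.
by rewrite lerBlDr lerDl exprn_ge0// ltW.
Qed.

Lemma sum_sqr_geometric_le n (q : R) : 0 <= q ->
  \sum_(0 <= k < n) k.+1%:R ^+ 2 * q ^+ k.+1 <=
  \sum_(0 <= k < n) k.+1%:R ^+ 3 * q ^+ k.+1.
Proof.
move=> q0; apply: ler_sum => k _; rewrite ler_wpM2r ?exprn_ge0//.
by rewrite [leRHS]exprS ler_peMl ?exprn_ge0// ler1n.
Qed.

End finite_differences.

(** * Consistency and stability *)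

Section stress.
Variable R : realType.
Implicit Types (r e b : int -> R) (j c p : int) (k n M N K : nat) (m th : R).

Lemma wsum_reflect r a j k : (forall p, r (a - p) = r p) ->
  wsum r (a - j) k.+1 = wsum r (j - k%:Z) k.+1.
Proof.
move=> h; rewrite /wsum [LHS]big_nat_rev/= add0n !big_nat; apply: eq_bigr => i /= ik.
by rewrite -[RHS]h; congr r; lia.
Qed.

Lemma sig_reflect m n r a j : (forall p, r (a - p) = r p) ->
  sig m n r (a - j) = sig m n r j.
Proof.
move=> h; apply: eq_bigr => k _; rewrite [LHS]big_nat_rev/= add0n !big_nat.
apply: eq_bigr => i /= ik; rewrite /wexp.
have -> : a - j - (k.+1 - i.+1)%N%:Z = a - (j + (k - i)%N%:Z) by rewrite subSS; lia.
rewrite (wsum_reflect _ _ h); congr (expR (_ * _)).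
by rewrite (_ : j + (k - i)%N%:Z - k%:Z = j - i%:Z)//; lia.
Qed.

Lemma wexp_dist m s r r' j k : 0 < m -> (forall p, s <= r p) ->
  (forall p, s <= r' p) ->
  `|wexp m r j k - wexp m r' j k| <=
  m * expR (- m * s) ^+ k * \sum_(0 <= i < k) `|r (j + i%:Z) - r' (j + i%:Z)|.
Proof.
move=> m0 hr hr'; rewrite -expRM_natl.
have q f : (forall i, s <= f i) -> - m * wsum f j k <= k%:R * (- m * s).
  move=> h; rewrite (_ : k%:R * (- m * s) = - (m * (k%:R * s))); last ring.
  by rewrite mulNr lerN2 ler_pM2l//; exact: wsum_ge.
apply: (le_trans (exp_dist (q _ hr) (q _ hr'))).
rewrite mulrAC ler_wpM2r ?expR_ge0// -mulrBr normrM normrN (gtr0_norm m0).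
by rewrite ler_pM2l// /wsum -sumrB ler_norm_sum.
Qed.

Definition window_sum b j k : R := \sum_(0 <= t < k.*2.+1) b (j + (t%:Z - k%:Z)).

(** There are k + 1 windows of k + 1 bonds through [j], all within distance k of it, hence the
    square. Of the decay th^(2 k + 2), one half is handed to the hypothesis on [beta] and the other
    half kept for the sum over k. *)
Lemma sig_dist m th r r' j n (beta : nat -> R) s : 0 < m -> 0 < th ->
  th ^+ 2 = expR (- m * s) -> (forall p, s <= r p) -> (forall p, s <= r' p) ->
  (forall k p, j - k%:Z <= p <= j + k%:Z -> `|r p - r' p| * th ^+ k <= beta k) ->
  `|sig m n r j - sig m n r' j| <=
  m * \sum_(0 <= k < n) k.+1%:R ^+ 2 * th ^+ k.+1 * beta k.+1.
Proof.
move=> m0 th0 thE hr hr' hb; rewrite /sig -sumrB mulr_sumr.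
apply: (le_trans (ler_norm_sum _ _ _)); apply: ler_sum => k _.
rewrite -sumrB; apply: (le_trans (ler_norm_sum _ _ _)).
have -> : m * (k.+1%:R ^+ 2 * th ^+ k.+1 * beta k.+1) =
    \sum_(0 <= i < k.+1) (k.+1%:R * (m * th ^+ k.+1 * beta k.+1)).
  by rewrite sumr_const_nat subn0 -[RHS]mulr_natl; ring.
apply: ler_sum_nat => i /andP[_ ik].
apply: (le_trans (wexp_dist _ _ m0 hr hr')).
rewrite -thE -exprM mulnC exprM expr2 mulr_sumr mulr_natl -[X in _ *+ X]subn0.
rewrite -sumr_const_nat; apply: ler_sum_nat => l /andP[_ lk].
rewrite mulrA -!mulrA ler_pM2l// ler_wpM2l ?exprn_ge0 ?(ltW th0)// mulrC.
by apply: hb; apply/andP; split; lia.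
Qed.

(** Telescoping from p to p'. As [b i] bounds the step from i to i + 1, the last index used is p' -
    1, hence the bound j + k + 1 on p'. *)
Lemma path_dist r b j k p p' th : 0 <= th -> (forall i, 0 <= b i) ->
  j - k%:Z <= p -> p <= p' -> p' <= j + k.+1%:Z ->
  (forall i, p <= i < p' -> `|r (i + 1) - r i| * th <= b i) ->
  `|r p' - r p| * th <= window_sum b j k.
Proof.
move=> th0 b0 jp pp' p'j hb.
have [L E] : exists L : nat, p' = p + L%:Z by exists `|p' - p|%N; lia.
move: hb p'j; rewrite {}E => {p' pp'} hb hL.
have tel : `|r (p + L%:Z) - r p| * th <= \sum_(0 <= i < L) b (p + i%:Z).
  elim: L hL hb => [|L ih] hL hb.
    by rewrite addr0 subrr normr0 mul0r big_nil.
  rewrite big_nat_recr//=.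
  have E : p + L.+1%:Z = p + L%:Z + 1 by lia.
  have -> : r (p + L.+1%:Z) - r p = (r (p + L%:Z) - r p) + (r (p + L%:Z + 1) - r (p + L%:Z)).
    by rewrite E; ring.
  apply: (le_trans (ler_wpM2r th0 (ler_normD _ _))); rewrite mulrDl.
  apply: lerD; last by apply: hb; lia.
  by apply: ih => [|i hi]; [lia|apply: hb; lia].
apply: (le_trans tel).
have [d dE] : exists d : nat, p = j + (d%:Z - k%:Z) by exists (absz (p - j + k%:Z)); lia.
rewrite /window_sum [leRHS](@big_cat_nat _ _ _ d)//=; last lia.
rewrite [X in _ <= _ + X](@big_cat_nat _ _ _ (d + L))//=; [|lia|lia].
rewrite (sum_offset d) [leRHS]addrC -addrA.
have -> : \sum_(0 <= i < L) b (p + i%:Z) =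
    \sum_(0 <= i < L) b (j + ((d + i)%N%:Z - k%:Z)).
  by apply: eq_bigr => i _; congr b; lia.
by rewrite lerDl addr_ge0// sumr_ge0.
Qed.

(** By periodicity the shifted products |e_j| b_(j + t) obey the same Young inequality for every
    offset t. A window sum of radius k + 1 has 2 k + 3 <= 3 (k + 1) offsets: hence the factor 3 and
    the third power in the hypothesis. *)
Lemma window_stress_sum (M : nat) b e c m th n C al : 0 < m -> 0 < th -> 0 < al ->
  (forall p, b (p + M%:Z) = b p) -> (forall p, e (p + M%:Z) = e p) ->
  (\sum_(0 <= k < n) k.+1%:R ^+ 3 * th ^+ k.+1 <= C) ->
  \sum_(0 <= j < M) `|e (c + j%:Z)| *
    (m * \sum_(0 <= k < n) k.+1%:R ^+ 2 * th ^+ k.+1 * window_sum b (c + j%:Z) k.+1)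
  <= 3 * m * C * 2^-1 * (al * (\sum_(0 <= j < M) e (c + j%:Z) ^+ 2)
                    + (\sum_(0 <= j < M) b (c + j%:Z) ^+ 2) / al).
Proof.
move=> m0 th0 al0 hb he hC.
set E2 := \sum_(0 <= j < M) e (c + j%:Z) ^+ 2.
set B2 := \sum_(0 <= j < M) b (c + j%:Z) ^+ 2.
set Q := al * E2 + B2 / al.
have Q0 : 0 <= Q.
  rewrite addr_ge0 ?divr_ge0 ?mulr_ge0 ?(ltW al0)//; apply: sumr_ge0 => *; exact: sqr_ge0.
have one (t : int) : \sum_(0 <= j < M) `|e (c + j%:Z)| * b (c + j%:Z + t) <= 2^-1 * Q.
  rewrite /Q /E2; have -> : B2 = \sum_(0 <= j < M) b (c + j%:Z + t) ^+ 2.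
    have hb2 p : b (p + M%:Z) ^+ 2 = b p ^+ 2 by rewrite hb.
    rewrite /B2 (@sum_period_shift _ (fun p => b p ^+ 2) M c (c + t) hb2).
    by apply: eq_bigr => j _; rewrite addrAC.
  rewrite mulr_sumr mulr_suml -big_split/= mulr_sumr; apply: ler_sum => j _.
  set x := e _; set y := b _.
  have : 0 <= (al * `|x| - y) ^+ 2 / al by rewrite divr_ge0 ?sqr_ge0// ltW.
  have -> : (al * `|x| - y) ^+ 2 / al = al * `|x| ^+ 2 + y ^+ 2 / al - 2 * (`|x| * y).
    by field; rewrite lt0r_neq0.
  by rewrite real_normK ?num_real//; lra.
have win k : \sum_(0 <= j < M) `|e (c + j%:Z)| * window_sum b (c + j%:Z) k <=
    k.*2.+1%:R * (2^-1 * Q).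
  rewrite /window_sum; under eq_bigr do rewrite mulr_sumr.
  rewrite exchange_big_nat/= mulr_natl -[X in _ *+ X]subn0 -sumr_const_nat.
  by apply: ler_sum => t _; exact: one.
have -> : \sum_(0 <= j < M) `|e (c + j%:Z)| *
    (m * \sum_(0 <= k < n) k.+1%:R ^+ 2 * th ^+ k.+1 * window_sum b (c + j%:Z) k.+1) =
  m * \sum_(0 <= k < n) (k.+1%:R ^+ 2 * th ^+ k.+1 *
     \sum_(0 <= j < M) `|e (c + j%:Z)| * window_sum b (c + j%:Z) k.+1).
  rewrite mulr_sumr; under [RHS]eq_bigr do rewrite mulr_sumr mulr_sumr.
  rewrite [RHS]exchange_big_nat/=; apply: eq_bigr => j _.
  by rewrite mulrCA mulr_sumr mulr_sumr; apply: eq_bigr => k _; ring.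
have -> : 3 * m * C * 2^-1 * Q = m * (C * (3 * (2^-1 * Q))) by ring.
rewrite ler_pM2l//.
apply: (@le_trans _ _ ((\sum_(0 <= k < n) k.+1%:R ^+ 3 * th ^+ k.+1) * (3 * (2^-1 * Q)))).
  rewrite mulr_suml; apply: ler_sum => k _.
  apply: (@le_trans _ _ (k.+1%:R ^+ 2 * th ^+ k.+1 * (k.+1.*2.+1%:R * (2^-1 * Q)))).
    by rewrite ler_wpM2l ?mulr_ge0 ?exprn_ge0 ?(ltW th0).
  have -> : k.+1%:R ^+ 3 * th ^+ k.+1 * (3 * (2^-1 * Q)) =
    k.+1%:R ^+ 2 * th ^+ k.+1 * ((3 * k.+1%:R) * (2^-1 * Q)) by ring.
  rewrite ler_wpM2l ?mulr_ge0 ?exprn_ge0 ?(ltW th0)// ler_wpM2r ?mulr_ge0//.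
  by rewrite -natrM ler_nat; lia.
by rewrite ler_wpM2r// ?mulr_ge0.
Qed.

End stress.

(* Reflection of the bonds onto the bonds -K, ..., K + 1 touching the atomistic
   region; the mirrors are the bonds -K and K + 1. *)
Definition fold (K : nat) (p : int) : int :=
  let x := ((p + K%:Z) %% (K.*2.+1 + K.*2.+1)%N%:Z)%Z in
  if x <= (K.*2.+1)%:Z then x - K%:Z else (K.*2.+1 + K.*2.+1)%N%:Z - x - K%:Z.

(* Representative in [-N, N] modulo 2N + 1. *)
Definition rep (N : nat) (p : int) : int := ((p + N%:Z) %% (N.*2.+1)%:Z)%Z - N%:Z.

(** * Reflected and periodic indices *)

Section index_maps.
Implicit Types (K N : nat) (p j z : int).

Lemma foldP K p : exists z, (- K%:Z <= fold K p <= K.+1%:Z) /\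
  (fold K p = p + z * (K.*2.+1 + K.*2.+1)%N%:Z \/
   fold K p = - (K.*2)%:Z - p + z * (K.*2.+1 + K.*2.+1)%N%:Z).
Proof.
rewrite /fold; set M := (K.*2.+1 + K.*2.+1)%N.
have M0 : M%:Z != 0 by [].
have x0 : 0 <= ((p + K%:Z) %% M)%Z by rewrite modz_ge0.
have xM : ((p + K%:Z) %% M)%Z < M%:Z by rewrite ltz_pmod.
have := divz_eq (p + K%:Z) M.
set x := (_ %% _)%Z in x0 xM *; set z := (_ %/ _)%Z => E.
case: ifPn => xK; [exists (- z)|exists (z + 1)]; split.
- by rewrite /M in x0 xM xK *; lia.
- by left; rewrite mulNr; lia.
- by rewrite /M in x0 xM xK *; lia.
- by right; rewrite mulrDl mul1r; lia.
Qed.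

Lemma fold_id K p : - K%:Z <= p <= K.+1%:Z -> fold K p = p.
Proof.
move=> pK; rewrite /fold modz_small; last by lia.
by case: ifPn; lia.
Qed.

Lemma fold_periodic K p : fold K (p + (K.*2.+1 + K.*2.+1)%N%:Z) = fold K p.
Proof. by rewrite /fold addrAC modzDr. Qed.

Lemma fold_reflect K p : fold K ((K.+1).*2%:Z - p) = fold K p.
Proof.
rewrite /fold; set M := (K.*2.+1 + K.*2.+1)%N.
have M0 : M%:Z != 0 by [].
have x0 : 0 <= ((p + K%:Z) %% M)%Z by rewrite modz_ge0.
have xM : ((p + K%:Z) %% M)%Z < M%:Z by rewrite ltz_pmod.
have := divz_eq (p + K%:Z) M.
set x := (_ %% _)%Z in x0 xM *; set z := (_ %/ _)%Z => E.
have -> : (K.+1).*2%:Z - p + K%:Z = (1 - z) * M%:Z + (- x).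
  by rewrite mulrBl mul1r /M; lia.
rewrite modzMDl; have [x00|xn0] := eqVneq x 0.
  by rewrite x00 oppr0 mod0z.
have -> : (- x %% M)%Z = M%:Z - x.
  by rewrite -(modzDr (- x)) modz_small; lia.
by case: ifPn; case: ifPn; rewrite /M; lia.
Qed.

(** The image never lies farther inside than the first mirror image; so [p] and its image stay
    equally close to the interface, and the bonds between them too. *)
Lemma fold_le K p : p <= - K%:Z -> fold K p <= - (K.*2)%:Z - p.
Proof.
move=> pK; have [z [fK [E|E]]] := foldP K p.
  have [z0|z0] := leP z 0; first by have : z * (K.*2.+1 + K.*2.+1)%N%:Z <= 0; nia.
  have : (K.*2.+1 + K.*2.+1)%N%:Z <= z * (K.*2.+1 + K.*2.+1)%N%:Z by nia.
  nia.
have [z0|z0] := leP z 0; first by have : z * (K.*2.+1 + K.*2.+1)%N%:Z <= 0; nia.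
have : (K.*2.+1 + K.*2.+1)%N%:Z <= z * (K.*2.+1 + K.*2.+1)%N%:Z by nia.
lia.
Qed.

Lemma fold_ge K p : K.+1%:Z <= p -> (K.+1).*2%:Z - p <= fold K p.
Proof.
move=> pK; have [z [fK [E|E]]] := foldP K p.
  have [z0|z0] := leP 0 z; first by have : 0 <= z * (K.*2.+1 + K.*2.+1)%N%:Z; nia.
  have : z * (K.*2.+1 + K.*2.+1)%N%:Z <= - (K.*2.+1 + K.*2.+1)%N%:Z by nia.
  lia.
have [z0|z0] := leP z 0; first by have : z * (K.*2.+1 + K.*2.+1)%N%:Z <= 0; nia.
have : (K.*2.+1 + K.*2.+1)%N%:Z <= z * (K.*2.+1 + K.*2.+1)%N%:Z by nia.
lia.
Qed.

Lemma rep_periodic N p : rep N (p + (N.*2.+1)%:Z) = rep N p.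
Proof. by rewrite /rep (addrAC p) modzDr. Qed.

Lemma rep_id N p : - N%:Z <= p <= N%:Z -> rep N p = p.
Proof. by move=> pN; rewrite /rep modz_small; lia. Qed.

Lemma repP N p : exists z, - N%:Z <= rep N p <= N%:Z /\
  p = rep N p + z * (N.*2.+1)%:Z.
Proof.
have M0 : (N.*2.+1)%:Z != 0 by [].
have x0 : 0 <= ((p + N%:Z) %% (N.*2.+1)%:Z)%Z by rewrite modz_ge0.
have xM : ((p + N%:Z) %% (N.*2.+1)%:Z)%Z < (N.*2.+1)%:Z by rewrite ltz_pmod.
have := divz_eq (p + N%:Z) (N.*2.+1)%:Z; rewrite /rep.
set x := (_ %% _)%Z in x0 xM *; set z := (_ %/ _)%Z => E.
by exists z; split; lia.
Qed.

(** The truncated difference is the depth of [q] in the atomistic region, 0 outside. From depth 0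
    each step gains at most one level, also when the path leaves [-N, N] and re-enters at the other
    end. *)
Lemma rep_depth N K q j k : (K < N)%N -> - N%:Z <= j <= N%:Z -> K%:Z <= `|j| ->
  `|q - j| <= k%:Z -> (K - `|rep N q|%N <= k)%N.
Proof.
move=> KN jN Kj qk; have [z [rN E]] := repP N q.
have [z0|[z0|z0]] : z = 0 \/ (z <= -1 \/ 1 <= z) by lia.
- by move: E; rewrite z0 mul0r addr0 => E; lia.
- have : z * (N.*2.+1)%:Z <= - (N.*2.+1)%:Z by nia.
  lia.
- have : (N.*2.+1)%:Z <= z * (N.*2.+1)%:Z by nia.
  lia.
Qed.

End index_maps.

(** * Weighted sums over cells and the reflected chain *)

Section ac_sum.
Variable R : realType.
Variables (K N : nat).
Hypothesis KN : (K < N)%N.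
Implicit Types (G F : int -> R) (H : R).

(* [H / 2] because the reflected chain contains the atomistic region twice. *)
Definition acsum G H : R :=
  \sum_(K.+1 <= i < N.+1) G (- i%:Z) + G (- K%:Z) / 2 + G K.+1%:Z / 2 +
  \sum_(K.+2 <= i < N.+1) G i%:Z + H / 2.

Lemma acsumD G G' H H' :
  acsum (fun j => G j + G' j) (H + H') = acsum G H + acsum G' H'.
Proof. by rewrite /acsum !big_split/=; field. Qed.

Lemma acsumN G H : acsum (fun j => - G j) (- H) = - acsum G H.
Proof. by rewrite /acsum !sumrN; field. Qed.

Lemma acsumB G G' H H' :
  acsum (fun j => G j - G' j) (H - H') = acsum G H - acsum G' H'.
Proof. by rewrite acsumD acsumN. Qed.

Lemma acsumZ a G H : acsum (fun j => a * G j) (a * H) = a * acsum G H.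
Proof. by rewrite /acsum -!mulr_sumr; field. Qed.

Lemma acsum_le G G' H H' :
  (forall j, - N%:Z <= j <= N%:Z -> K%:Z <= `|j| -> G j <= G' j) -> H <= H' ->
  acsum G H <= acsum G' H'.
Proof.
move=> GG HH; rewrite /acsum; have h2 : 0 <= (2 : R)^-1 by rewrite invr_ge0.
apply: lerD; last by rewrite ler_wpM2r.
apply: lerD; last by apply: ler_sum_nat => i /andP[? ?]; apply: GG; lia.
apply: lerD; last by rewrite ler_wpM2r//; apply: GG; lia.
apply: lerD; last by rewrite ler_wpM2r//; apply: GG; lia.
by apply: ler_sum_nat => i /andP[? ?]; apply: GG; lia.
Qed.

(* The cell weights and the folded atomistic bonds form a partition of unity. *)
Lemma acsum_partition F :
  acsum F (\sum_(0 <= i < K.*2.+1 + K.*2.+1) F (fold K (1 - K%:Z + i%:Z))) =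
  sum_sym N F.
Proof.
have foldl i : (i < K.*2.+1)%N -> fold K (1 - K%:Z + i%:Z) = 1 - K%:Z + i%:Z.
  by move=> iK; apply: fold_id; lia.
have foldr i : (i < K.*2.+1)%N ->
    fold K (1 - K%:Z + (K.*2.+1 + i)%N%:Z) = K%:Z - i%:Z.
  by move=> iK; rewrite -fold_reflect fold_id; lia.
(* A reflected period meets the inner bonds twice but each mirror bond once; after halving, the half
   cells -K and K + 1 supply what is missing. *)
have -> : \sum_(0 <= i < K.*2.+1 + K.*2.+1) F (fold K (1 - K%:Z + i%:Z)) =
    2 * (\sum_(0 <= i < K.*2) F (1 - K%:Z + i%:Z)) + F K.+1%:Z + F (- K%:Z).
  rewrite (@big_cat_nat _ _ _ K.*2.+1)//= ?leq_addr// (sum_offset K.*2.+1).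
  rewrite [X in X + _]big_nat_recr//= [X in _ + X]big_nat_recr//=.
  rewrite foldl// foldr//.
  have -> : \sum_(0 <= i < K.*2) F (fold K (1 - K%:Z + i%:Z)) =
      \sum_(0 <= i < K.*2) F (1 - K%:Z + i%:Z).
    by rewrite !big_nat; apply: eq_bigr => i /= iK; rewrite foldl//; lia.
  have -> : \sum_(0 <= i < K.*2) F (fold K (1 - K%:Z + (K.*2.+1 + i)%N%:Z)) =
      \sum_(0 <= i < K.*2) F (1 - K%:Z + i%:Z).
    rewrite [RHS]big_nat_rev/= !big_nat; apply: eq_bigr => i /= iK.
    by rewrite foldr; [congr F; lia|lia].
  have -> : 1 - K%:Z + K.*2%:Z = K.+1%:Z by lia.
  have -> : K%:Z - K.*2%:Z = - K%:Z by lia.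
  ring.
rewrite /acsum /sum_sym.
have E : N.*2.+1 = ((N - K) + (1 + (K.*2 + (1 + (N - K.+1)))))%N by lia.
rewrite E [RHS](@big_cat_nat _ _ _ (N - K))//= ?leq_addr// (sum_offset (N - K)).
rewrite [X in _ = _ + X](@big_cat_nat _ _ _ 1)//= ?leq_addr// big_nat1 (sum_offset 1).
rewrite [X in _ = _ + (_ + X)](@big_cat_nat _ _ _ K.*2)//= ?leq_addr// (sum_offset K.*2).
rewrite [X in _ = _ + (_ + (_ + X))](@big_cat_nat _ _ _ 1)//= ?leq_addr// big_nat1
  (sum_offset 1).
have -> : \sum_(K.+1 <= i < N.+1) F (- i%:Z) = \sum_(0 <= i < N - K) F (i%:Z - N%:Z).
  have -> : N.+1 = (K.+1 + (N - K))%N by lia.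
  rewrite (sum_offset K.+1) big_nat_rev/= add0n !big_nat.
  by apply: eq_bigr => i /= iK; congr F; lia.
have -> : \sum_(K.+2 <= i < N.+1) F i%:Z =
    \sum_(0 <= i < N - K.+1) F ((N - K + (1 + (K.*2 + (1 + i))))%N%:Z - N%:Z).
  have -> : N.+1 = (K.+2 + (N - K.+1))%N by lia.
  rewrite (sum_offset K.+2); apply: eq_bigr => i _; congr F; lia.
have -> : \sum_(0 <= i < K.*2) F ((N - K + (1 + i))%N%:Z - N%:Z) =
    \sum_(0 <= i < K.*2) F (1 - K%:Z + i%:Z).
  by apply: eq_bigr => i _; congr F; lia.
have -> : (N - K + 0)%N%:Z - N%:Z = - K%:Z by lia.
have -> : (N - K + (1 + (K.*2 + 0)))%N%:Z - N%:Z = K.+1%:Z by lia.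
by field.
Qed.

End ac_sum.

(** * Strong convexity of the coupled sum and stress consistency *)

Section chain_stability.
Variable R : realType.
Implicit Types (r e b : int -> R) (j c p : int) (k n M N K : nat) (m th : R).

Definition Phi_ac m K N n r : R :=
  acsum K N (fun j => Phi m 1 j n (fun=> r j))
    (Phi m (K.*2.+1 + K.*2.+1) (1 - K%:Z) n (fun p => r (fold K p))).

Lemma sum_symE N (F : int -> R) :
  sum_sym N F = \sum_(0 <= i < N.*2.+1) F (- N%:Z + i%:Z).
Proof. by apply: eq_bigr => i _; rewrite addrC. Qed.

(** The partition of unity distributes the sum of squares over the cells and the reflected chain,
    each of which has its own convexity bound. *)
Lemma Phi_ac_four_points m K N n r e t S0 : (K < N)%N -> 0 < m -> 0 <= t <= 1 ->
  (forall j, r j <= S0) -> (forall j, r j + e j <= S0) ->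
  t * (1 - t) * (m ^+ 2 * expR (- m * S0)) * sum_sym N (fun j => e j ^+ 2) <=
  Phi_ac m K N n.+1 (fun i => r i + e i)
  - Phi_ac m K N n.+1 (fun i => r i + (1 - t) * e i)
  - Phi_ac m K N n.+1 (fun i => r i + t * e i) + Phi_ac m K N n.+1 r.
Proof.
move=> KN m0 t01 rS reS; rewrite -(acsum_partition KN) -acsumZ /Phi_ac.
rewrite -!acsumB -acsumD; apply: acsum_le => // [j _ _|].
  have := @Phi_four_points R m 1 j n (fun=> r j) (fun=> e j) t S0 m0 t01
    (fun=> rS j) (fun=> reS j).
  by rewrite big_nat1.
exact: (@Phi_four_points R m (K.*2.+1 + K.*2.+1) (1 - K%:Z) n
  (fun p => r (fold K p)) (fun p => e (fold K p)) t S0 m0 t01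
  (fun p => rS _) (fun p => reS _)).
Qed.

Lemma Phi_ac_tangent m K N n r e t : (K < N)%N ->
  - (t * m) * acsum K N (fun j => e j * sig m n (fun=> r j) j)
    (\sum_(0 <= i < K.*2.+1 + K.*2.+1) e (fold K (1 - K%:Z + i%:Z)) *
       sig m n (fun p => r (fold K p)) (1 - K%:Z + i%:Z)) <=
  Phi_ac m K N n (fun i => r i + t * e i) - Phi_ac m K N n r.
Proof.
move=> KN; rewrite -acsumZ /Phi_ac -acsumB; apply: acsum_le => // [j _ _|].
  have := @Phi_tangent R m 1 j n (fun=> r j) (fun=> e j) t
    (fun=> erefl) (fun=> erefl).
  by rewrite big_nat1 addr0.
apply: (@Phi_tangent R m _ _ n (fun p => r (fold K p)) (fun p => e (fold K p))).
  by move=> p; rewrite fold_periodic.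
by move=> p; rewrite fold_periodic.
Qed.

Section consistency.
Variables (m s0 th : R) (N K : nat) (r b : int -> R).
Hypotheses (m0 : 0 < m) (s00 : 0 < s0) (KN : (K < N)%N).
Hypothesis th0 : 0 < th.
Hypothesis th1 : th <= 1.
Hypothesis thE : th ^+ 2 = expR (- m * s0).
Hypothesis rs : forall p, s0 <= r p.
Hypothesis b0 : forall p, 0 <= b p.
Hypothesis rb : forall p,
  `|r (p + 1) - r p| * th ^+ (K - `|rep N p|%N) <= b p.

(** The exchange of decay for weight: starting outside the atomistic region, k steps reach depth at
    most k, and th <= 1. *)
Let weight_le q j k : - N%:Z <= j <= N%:Z -> K%:Z <= `|j| -> `|q - j| <= k%:Z ->
  `|r (q + 1) - r q| * th ^+ k <= b q.
Proof.
move=> jN Kj qj; apply: le_trans (rb q); rewrite ler_wpM2l//.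
by apply: ler_wiXn2l; rewrite ?(ltW th0) ?th1//; exact: rep_depth qj.
Qed.

Lemma sig_cb_dist n j : - N%:Z <= j <= N%:Z -> K%:Z <= `|j| ->
  `|sig m n (fun=> r j) j - sig m n r j| <=
  m * \sum_(0 <= k < n) k.+1%:R ^+ 2 * th ^+ k.+1 * window_sum b j k.+1.
Proof.
move=> jN Kj; apply: (@sig_dist _ m th _ _ j n (window_sum b j) s0 m0 th0 thE) => //.
move=> k p /andP[jp pj]; have thk : 0 <= th ^+ k by rewrite exprn_ge0// ltW.
have [pj'|jp'] := leP p j.
  apply: path_dist => //; first by lia.
  by move=> i /andP[pi ij]; apply: (weight_le jN Kj); lia.
rewrite distrC; apply: path_dist => //; [lia|lia|lia|].
by move=> i /andP[pi ij]; apply: (weight_le jN Kj); lia.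
Qed.

(** Bonds of a window inside the region are unchanged. A bond beyond an interface is replaced by its
    image, and the path between them stays within distance k of that interface, even if [j] itself
    is deep inside; so [weight_le] is applied from -K or K rather than from [j]. *)
Lemma sig_at_dist n j : - K%:Z <= j <= K.+1%:Z ->
  `|sig m n (fun p => r (fold K p)) j - sig m n r j| <=
  m * \sum_(0 <= k < n) k.+1%:R ^+ 2 * th ^+ k.+1 * window_sum b j k.+1.
Proof.
move=> jK; apply: (@sig_dist _ m th _ _ j n (window_sum b j) s0 m0 th0 thE) => // k p /andP[jp pj].
have thk : 0 <= th ^+ k by rewrite exprn_ge0// ltW.
have [z [fK _]] := foldP K p.
have [pK|Kp] := leP p (- K%:Z).
  have fp := fold_le pK; apply: path_dist => //; [lia|lia|].
  by move=> i /andP[pi ip]; apply: (@weight_le _ (- K%:Z)); lia.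
have [pK|{}Kp] := leP p K.+1%:Z.
  rewrite fold_id; last by lia.
  by rewrite subrr normr0 mul0r sumr_ge0.
have fp := fold_ge (ltW Kp); rewrite distrC; apply: path_dist => //; [lia|lia|lia|].
by move=> i /andP[pi ip]; apply: (@weight_le _ K%:Z); lia.
Qed.

(** The second half of the period is the mirror image of the first, where [sig_at_dist] applies. *)
Lemma sig_fold_dist n i : (i < K.*2.+1 + K.*2.+1)%N ->
  `|sig m n (fun p => r (fold K p)) (1 - K%:Z + i%:Z)
    - sig m n r (fold K (1 - K%:Z + i%:Z))| <=
  m * \sum_(0 <= k < n) k.+1%:R ^+ 2 * th ^+ k.+1 *
      window_sum b (fold K (1 - K%:Z + i%:Z)) k.+1.
Proof.
move=> iM; set l := 1 - K%:Z + i%:Z.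
have sym p : r (fold K ((K.+1).*2%:Z - p)) = r (fold K p) by rewrite fold_reflect.
have [lK|Kl] := leP l K.+1%:Z.
  have lK2 : - K%:Z <= l <= K.+1%:Z by rewrite /l; lia.
  by rewrite fold_id//; exact: sig_at_dist.
have lK2 : - K%:Z <= (K.+1).*2%:Z - l <= K.+1%:Z by rewrite /l in Kl *; lia.
rewrite -(@sig_reflect _ m n (fun p => r (fold K p)) (K.+1).*2%:Z l sym).
by rewrite -(fold_reflect K l) fold_id//; exact: sig_at_dist.
Qed.

Lemma stress_consistency n e :
  acsum K N (fun j => e j * sig m n (fun=> r j) j)
    (\sum_(0 <= i < K.*2.+1 + K.*2.+1) e (fold K (1 - K%:Z + i%:Z)) *
       sig m n (fun p => r (fold K p)) (1 - K%:Z + i%:Z))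
  - sum_sym N (fun j => e j * sig m n r j) <=
  sum_sym N (fun j => `|e j| *
    (m * \sum_(0 <= k < n) k.+1%:R ^+ 2 * th ^+ k.+1 * window_sum b j k.+1)).
Proof.
rewrite -!(acsum_partition KN) -acsumB.
apply: acsum_le => // [j jN Kj|].
  rewrite -mulrBr; apply: (le_trans (ler_norm _)); rewrite normrM.
  by rewrite ler_wpM2l//; exact: sig_cb_dist.
rewrite -sumrB; apply: ler_sum_nat => i /andP[_ iM].
rewrite -mulrBr; apply: (le_trans (ler_norm _)); rewrite normrM.
by rewrite ler_wpM2l//; exact: sig_fold_dist.
Qed.

End consistency.

(** The limit t -> 0. If b < a, the chosen t makes t (a + c) at most (a - b) / 2, contradicting a -
    b <= t (a + c). *)
Lemma le_of_slope (a b c : R) :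
  (forall t, 0 < t < 1 -> a * (1 - t) <= b + t * c) -> a <= b.
Proof.
move=> h; rewrite leNgt; apply/negP => ba.
have d0 : 0 < `|a| + `|c| + 1 by rewrite ltr_wpDl// addr_ge0.
pose t := Num.min 2^-1 ((a - b) / (2 * (`|a| + `|c| + 1))).
have t0 : 0 < t by rewrite lt_min invr_gt0 ltr0n/= divr_gt0 ?subr_gt0 ?mulr_gt0.
have t1 : t < 1 by rewrite gt_min; apply/orP; left; lra.
have := h t; rewrite t0 t1 => /(_ isT) ht.
have t2 : t * (2 * (`|a| + `|c| + 1)) <= a - b.
  by rewrite -ler_pdivlMr ?mulr_gt0// ge_min lexx orbT.
have := ler_norm a; have := ler_norm c; have := normr_ge0 a; have := normr_ge0 c.
nra.
Qed.

(** The limit hypothesis is the force-free form of minimality: moving by t from [r] towards [r']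
    costs the full energy at least as much as the coupled energy gains on the last fraction t of the
    segment. *)
Lemma chain_stability (m s0 S0 : R) : 0 < m -> 0 < s0 -> exists2 C : R, 0 < C &
  forall N K r r', (K < N)%N ->
  (forall j, r (j + (N.*2.+1)%:Z) = r j) -> (forall j, r' (j + (N.*2.+1)%:Z) = r' j) ->
  (forall j, s0 <= r j <= S0) -> (forall j, s0 <= r' j <= S0) ->
  (forall t : R, 0 < t < 1 -> exists2 l : R, 0 <= l &
    (fun n => Phi m N.*2.+1 (- N%:Z) n (fun j => r j + t * (r' j - r j))
            - Phi m N.*2.+1 (- N%:Z) n r
            - (Phi_ac m K N n (fun j => r j + (r' j - r j))
            - Phi_ac m K N n (fun j => r j + (1 - t) * (r' j - r j)))) @ \oo --> l) ->
  sum_sym N (fun j => (r' j - r j) ^+ 2) <= C *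
  sum_sym N (fun j => expR (- m * s0) ^+ (K - `|j|%N) * (r (j + 1) - r j) ^+ 2).
Proof.
move=> m0 s00.
pose th := expR (- m * s0 / 2).
have th0 : 0 < th := expR_gt0 _.
have thE : th ^+ 2 = expR (- m * s0) by rewrite -expRM_natl; congr expR; field.
have th1 : th <= 1.
  by rewrite expR_le1 mulNr mulNr oppr_le0 divr_ge0// mulr_ge0// ltW.
(* Chosen so that exp(- 4 x) = th in [poly_geometric_bound]. *)
have x0 : 0 < m * s0 / 8 by rewrite divr_gt0// mulr_gt0.
have [C0 C00 hC0] := poly_geometric_bound x0.
have th4 : expR (- (4 * (m * s0 / 8))) = th by congr expR; field.
pose mu : R := m ^+ 2 * expR (- m * S0).
have mu0 : 0 < mu by rewrite mulr_gt0 ?exprn_gt0 ?expR_gt0.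
pose D := m * (3 * m * C0 * 2^-1).
have D0 : 0 < D by rewrite !mulr_gt0 ?invr_gt0.
exists (4 * D ^+ 2 / mu ^+ 2); first by rewrite divr_gt0 ?exprn_gt0// mulr_gt0 ?exprn_gt0.
move=> N K r r' KN hr hr' rb r'b hlim.
pose e j := r' j - r j.
(* The square of this factor th^depth is the weight of the norm; [rep] makes it periodic. *)
pose b p := th ^+ (K - `|rep N p|%N) * `|r (p + 1) - r p|.
set E2 := sum_sym N (fun j => (r' j - r j) ^+ 2).
have he p : e (p + (N.*2.+1)%:Z) = e p by rewrite /e hr hr'.
have b0 p : 0 <= b p by rewrite mulr_ge0// exprn_ge0// ltW.
have hb p : b (p + (N.*2.+1)%:Z) = b p.
  by rewrite /b rep_periodic addrAC !hr.
have BE : sum_sym N (fun j => expR (- m * s0) ^+ (K - `|j|%N) * (r (j + 1) - r j) ^+ 2) =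
    sum_sym N (fun j => b j ^+ 2).
  rewrite /sum_sym !big_nat; apply: eq_bigr => i /= iN.
  rewrite /b rep_id; last by lia.
  by rewrite exprMn real_normK ?num_real// -thE -!exprM mulnC.
rewrite BE; set B2 := sum_sym N _.
have rs p : s0 <= r p by case/andP: (rb p).
have rS p : r p <= S0 by case/andP: (rb p).
have r's p : s0 <= r' p by case/andP: (r'b p).
have r'S p : r' p <= S0 by case/andP: (r'b p).
have eS p : `|e p| <= S0.
  rewrite /e ler_norml; have := rs p; have := rS p; have := r's p; have := r'S p.
  by lra.
pose M2 : R := (N.*2.+1)%:R * (m * S0) ^+ 2 * C0.
have main al t : 0 < al -> 0 < t < 1 ->
    mu * E2 * (1 - t) <= D * (al * E2 + B2 / al) + t * M2.
  move=> al0 t01; have [t0 t1] := andP t01; have [l l0 hl] := hlim t t01.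
  have t01' : 0 <= t <= 1 by rewrite !ltW.
  suff : l <= t * (D * (al * E2 + B2 / al) + t * M2 - mu * E2 * (1 - t)).
    by move=> /(le_trans l0); rewrite pmulr_rge0//; lra.
  apply: (cvgr_to_le hl); near=> n0.
  have [n ->] : exists n, n0 = n.+1.
    exists n0.-1; rewrite prednK//; near: n0; exact: nbhs_infty_gt.
  set sg := sum_sym N (fun j => e j * sig m n.+1 r j).
  have H1 : Phi m N.*2.+1 (- N%:Z) n.+1 (fun j => r j + t * e j)
      - Phi m N.*2.+1 (- N%:Z) n.+1 r <= - (t * m) * sg + t ^+ 2 * M2.
    have ers p : s0 <= r p + t * e p.
      by have := rs p; have := r's p; rewrite /e; nra.
    apply: (le_trans (Phi_tangent_le (- N%:Z) n.+1 m0 hr he rs ers eS)).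
    rewrite /sg sum_symE lerD2l ler_wpM2l ?sqr_ge0//.
    rewrite ler_wpM2l ?(mulr_ge0 (ler0n _ _) (sqr_ge0 _))//.
    apply: (le_trans (sum_sqr_geometric_le n.+1 (expR_ge0 (- m * s0)))).
    apply: le_trans (hC0 n.+1); rewrite th4; apply: ler_sum => k _.
    rewrite ler_wpM2l ?exprn_ge0// -thE lerXn2r ?nnegrE ?exprn_ge0 ?(ltW th0)//.
    by rewrite expr2 ler_piMl// ltW.
  have rSe p : r p + e p <= S0 by rewrite /e subrKC.
  (* Transports the increment of the coupled sum from the far end of the segment to [r], gaining t
     (1 - t) mu E2. Both stresses are then compared at [r] only, so only second differences of the
     atomistic minimizer appear. *)
  have H2 := Phi_ac_four_points n KN m0 t01' rS rSe.
  have H3 := @Phi_ac_tangent m K N n.+1 r e t KN.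
  have rb' p : `|r (p + 1) - r p| * th ^+ (K - `|rep N p|%N) <= b p.
    by rewrite mulrC.
  have H4 := stress_consistency m0 s00 KN th0 th1 thE rs b0 rb' n.+1 e.
  have H5 : sum_sym N (fun j => `|e j| * (m * \sum_(0 <= k < n.+1)
      k.+1%:R ^+ 2 * th ^+ k.+1 * window_sum b j k.+1)) <=
      3 * m * C0 * 2^-1 * (al * E2 + B2 / al).
    rewrite /E2 /B2 !sum_symE; apply: window_stress_sum => //.
    by rewrite -th4; exact: hC0.
  set AC := acsum _ _ _ _ in H3 H4.
  rewrite -/mu -/E2 in H2; rewrite -/sg in H4.
  have H6 : t * m * (AC - sg) <= t * (D * (al * E2 + B2 / al)).
    rewrite /D -!mulrA ler_pM2l// ler_pM2l//; apply: (le_trans H4).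
    by apply: (le_trans H5); rewrite -!mulrA.
  move: H1 H2 H3 H6; rewrite -/E2 /e /=.
  lra.
have fin al : 0 < al -> mu * E2 <= D * (al * E2 + B2 / al).
  by move=> al0; apply: (@le_of_slope _ _ M2) => t t01; exact: main.
(* With this Young parameter half of mu E2 is absorbed on the left, which produces the constant 4
   D^2 / mu^2. *)
have al0 : 0 < mu / (2 * D) by rewrite divr_gt0// mulr_gt0.
have := fin _ al0.
have -> : D * (mu / (2 * D) * E2 + B2 / (mu / (2 * D))) =
    mu * E2 / 2 + 2 * D ^+ 2 / mu * B2 by field; rewrite !lt0r_neq0.
move=> h.
have h2 : mu * E2 <= 4 * D ^+ 2 / mu * B2 by lra.
rewrite -(ler_pM2l mu0); apply: (le_trans h2).
by rewrite le_eqVlt; apply/orP; left; apply/eqP; field; rewrite lt0r_neq0.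
Unshelve. all: by end_near. Qed.

End chain_stability.

(** * Comparison of the minimizers *)

Section reflected_positions.
Variable R : realType.
Variables (K : nat) (X : nat -> R) (a b m : R) (r : int -> R).
Local Notation n := (K.*2.+1).

(* One period of the chain of particles [X 0 .. X (2 K)] reflected at [a] and [b]. *)
Definition reflected (i : nat) : R :=
  if (i < n)%N then X i else
  if (i < n + n)%N then 2 * b - X (n.-1 - (i - n))%N else X 0%N + 2 * (b - a).

Lemma reflected_left i : (i < n)%N -> reflected i = X i.
Proof. by rewrite /reflected => ->. Qed.

Lemma reflected_right i : (i < n)%N ->
  reflected (n + i)%N = 2 * b - X (n.-1 - i)%N.
Proof. by move=> iN; rewrite /reflected ltnNge leq_addr/= ltn_add2l iN addKn. Qed.

Lemma reflected_end : reflected (n + n)%N = X 0%N + 2 * (b - a).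
Proof. by rewrite /reflected ltnNge leq_addr/= ltnn. Qed.

Hypothesis XS : forall i, X i.+1 - X i = m * r (1 - K%:Z + i%:Z).
Hypothesis X0 : 2 * (X 0%N - a) = m * r (- K%:Z).
Hypothesis XK : 2 * (b - X K.*2) = m * r K.+1%:Z.

(** The interfaces are midpoints of the bonds -K and K + 1, so the bond joining an end particle to
    its own image has the full length of that bond and occurs once per period. *)
Lemma reflected_bond i : (i < n + n)%N ->
  reflected i.+1 - reflected i = m * r (fold K (1 - K%:Z + i%:Z)).
Proof.
move=> iN; have [i1n|] := ltnP i.+1 n.
  rewrite !reflected_left//; last by lia.
  by rewrite XS fold_id//; lia.
rewrite leq_eqVlt => /predU1P[ni|].
  rewrite (reflected_left (i := i)); last by lia.
  rewrite -ni -[n]addn0 reflected_right; last by [].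
  rewrite (_ : (n.-1 - 0)%N = K.*2); last by lia.
  rewrite (_ : i = K.*2); last by lia.
  rewrite (_ : 1 - K%:Z + (K.*2)%:Z = K.+1%:Z); last by lia.
  rewrite fold_id; last by lia.
  by rewrite -XK; ring.
rewrite ltnS => ni; have [l lE] : exists l, i = (n + l)%N by exists (i - n)%N; lia.
have [i1n|] := ltnP i.+1 (n + n).
  rewrite lE -addnS !reflected_right; [|lia|lia].
  have -> : (n.-1 - l)%N = (n.-1 - l.+1).+1 by lia.
  transitivity (X (n.-1 - l.+1).+1 - X (n.-1 - l.+1)%N); first ring.
  rewrite XS -fold_reflect fold_id; last by lia.
  by congr (m * r _); lia.
move=> ni1; have {}ni1 : i.+1 = (n + n)%N by lia.
rewrite ni1 reflected_end lE reflected_right; last by lia.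
rewrite (_ : (n.-1 - l)%N = 0%N); last by lia.
rewrite -fold_reflect fold_id; last by lia.
rewrite (_ : (K.+1).*2%:Z - (1 - K%:Z + (n + l)%N%:Z) = - K%:Z); last by lia.
by rewrite -X0; ring.
Qed.

End reflected_positions.

(** * The energies as limits of interaction sums *)

Section chain_energies.
Variable R : realType.
Variables (m vs0 : R) (delta1 p w d : R -> R) (kappa dinf : R).
Hypotheses (m0 : 0 < m) (vs00 : 0 < vs0) (kappa0 : 0 < kappa).
Hypothesis supp : forall x, delta1 x != 0 -> - (vs0 / 2) <= x <= vs0 / 2.
Hypothesis hp : C1 p (fun x => expR (- m * x) * delta1 x).
Hypothesis hw : C1 w (fun x => expR (m * x) * delta1 x).
Hypothesis hd : C1 d (fun x => w x * (expR (- m * x) * delta1 x)).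
Hypothesis left0 : forall x, x <= - (vs0 / 2) -> [/\ p x = 0, w x = 0 & d x = 0].
Hypothesis right0 : forall x, vs0 / 2 <= x ->
  [/\ p x = kappa, w x = kappa & d x = dinf].
Variables (N : nat) (y : int -> R).
Local Notation mu := (@lebesgue_measure R).
Local Notation e := (eps R N).
Local Notation lam := (m / e).
Local Notation r := (d1 N y).

Lemma eps_gt0 : 0 < e. Proof. by rewrite divr_gt0. Qed.

Let e0 := eps_gt0.
Let e_neq0 : e != 0. Proof. exact: lt0r_neq0. Qed.
Let m_neq0 : m != 0. Proof. exact: lt0r_neq0. Qed.

Hypothesis ry : forall j, vs0 <= r j.
Hypothesis rper : forall j, r (j + (N.*2.+1)%:Z) = r j.

Lemma d1E j : y j - y (j - 1) = e * r j.
Proof. by rewrite /d1; field. Qed.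

Lemma particle_gap j : e * vs0 <= y (j + 1) - y j.
Proof. by have := d1E (j + 1); rewrite addrK => ->; rewrite ler_pM2l. Qed.

Lemma particle_sep (i k : int) : i < k -> e * vs0 <= y k - y i.
Proof.
move=> ik; have [l ->] : exists l : nat, k = i + 1 + l%:Z by exists (absz (k - i - 1)%R); lia.
elim: l => [|l ih]; first by rewrite addr0; exact: particle_gap.
have := particle_gap (i + 1 + l%:Z).
rewrite (_ : i + 1 + l.+1%:Z = i + 1 + l%:Z + 1); last lia.
have : 0 < e * vs0 by rewrite mulr_gt0.
lra.
Qed.

Lemma delta_eps_mul x : e * delta_eps delta1 N x = delta1 (x / e).
Proof. by rewrite /delta_eps mulrA mulfV ?mul1r. Qed.

(** Every other particle is at least e vs0 beyond an end of the interval, twice the half-width of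
    its charge. *)
Lemma rho_chain (a : int) (n : nat) (x : R) : y a < x < y (a + n%:Z) ->
  rho delta1 N y x = chain_rho e delta1 (fun i => y (a + i%:Z)) n.+1 x.
Proof.
move=> /andP[ax xn]; rewrite /rho /chain_rho.
have inj : injective (fun i : nat => a + i%:Z) by move=> i j; lia.
rewrite (@fsbigE _ _ _ _ _ [seq a + i%:Z | i <- index_iota 0 n.+1])//.
- rewrite big_map mulr_sumr big_seq_cond [RHS]big_seq_cond /=.
  apply: eq_big => [i|i _]; last by rewrite delta_eps_mul.
  by rewrite in_setT.
- by rewrite map_inj_uniq// iota_uniq.
- move=> j _ jn; have jan : j < a \/ a + n%:Z < j.
    have [ja|aj] := ltP j a; first by left.
    right; rewrite ltNge; apply: contra jn => jn.
    apply/mapP; exists (absz (j - a)%R); last by lia.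
    by rewrite mem_index_iota; lia.
  apply/eqP; rewrite /delta_eps mulf_eq0; apply/orP; right.
  apply: contraTT isT => /supp; rewrite ler_pdivlMr// ler_pdivrMr// => h.
  have v0 : 0 < e * vs0 by rewrite mulr_gt0.
  by case: jan => /particle_sep; lra.
Qed.

(** [r'] continues the bonds a + 1, ..., a + n with period n: it is [d1 N y] itself for the full
    chain, and a constant with n = 1 for a cell. Bond j ends at particle j, hence the shift by 1. *)
Lemma chain_energy_cvg (a : int) (n : nat) (r' : int -> R) : (0 < n)%N ->
  (forall j, r' (j + n%:Z) = r' j) -> (forall j, vs0 <= r' j) ->
  (forall i, (i < n)%N -> r' (a + 1 + i%:Z) = r (a + 1 + i%:Z)) ->
  (fun k => Phi m n (a + 1) k r') @ \oo -->
  (2 * m / e * periodic_energy e m (rho delta1 N y) (y a) (y (a + n%:Z)) -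
   n%:R * dinf) / kappa ^+ 2.
Proof.
move=> n0 hr' r'v rr'; pose Y i := y (a + i%:Z).
have gap i : (i < n)%N -> e * vs0 <= Y i.+1 - Y i.
  move=> _; rewrite /Y; have := particle_gap (a + i%:Z).
  by rewrite (_ : a + i%:Z + 1 = a + i.+1%:Z)//; lia.
have E := chain_periodic_energy m0 vs00 e0 supp hp hw hd left0 right0 gap n0.
have hZ i : (i < n)%N -> lam * Y i.+1 - lam * Y i = m * r' (a + 1 + i%:Z).
  move=> iN; rewrite rr'// -mulrBr /Y.
  rewrite (_ : a + i%:Z = a + i.+1%:Z - 1); last lia.
  by rewrite d1E (_ : a + 1 + i%:Z = a + i.+1%:Z); [field|lia].
have L := Phi_cvg (Z := fun i => lam * Y i) m0 vs00 n0 hr' r'v hZ.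
rewrite (@periodic_energy_ext R e m _ (chain_rho e delta1 Y n.+1)); last first.
  by move=> x; exact: rho_chain.
rewrite [X in periodic_energy _ _ _ X _](_ : y a = Y 0%N); last by rewrite /Y addr0.
rewrite -/(Y n) E; move: L; congr (_ --> _).
set T := expR (- lam * _); have -> : expR (- (lam * Y n - lam * Y 0%N)) = T.
  by congr expR; ring.
have -> : \sum_(0 <= k < n) \sum_(0 <= i < k) expR (lam * Y i - lam * Y k) =
    \sum_(0 <= k < n) \sum_(0 <= i < k) expR (lam * (Y i - Y k)).
  by apply: eq_bigr => k _; apply: eq_bigr => i _; rewrite mulrBr.
have -> : \sum_(0 <= i < n) expR (- (lam * Y i)) =
    \sum_(0 <= i < n) expR (- lam * Y i).
  by apply: eq_bigr => i _; rewrite mulNr.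
have T1 : 1 - T != 0.
  rewrite subr_eq0 gt_eqF// expR_lt1 mulNr oppr_lt0 mulr_gt0 ?divr_gt0// /Y.
  by rewrite (lt_le_trans _ (particle_sep _)) ?mulr_gt0//; lia.
by field; rewrite T1 m_neq0 e_neq0 lt0r_neq0.
Qed.

Lemma energy_cvg : (fun k => Phi m N.*2.+1 (- N%:Z) k r) @ \oo -->
  (2 * m / e * energy m delta1 N y - (N.*2.+1)%:R * dinf) / kappa ^+ 2.
Proof.
have h := @chain_energy_cvg (- (N.+1)%:Z) N.*2.+1 r erefl rper ry (fun _ _ => erefl).
rewrite (_ : - N.+1%:Z + 1 = - N%:Z) in h; last lia.
by rewrite (_ : - N.+1%:Z + N.*2.+1%:Z = N%:Z) in h; last lia.
Qed.

Lemma energy_cb_cell_cvg j : (fun k => Phi m 1 j k (fun=> r j)) @ \oo -->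
  (2 * m / e * energy_cb_cell m delta1 N y j - 1%:R * dinf) / kappa ^+ 2.
Proof.
have h := @chain_energy_cvg (j - 1) 1 (fun=> r j) erefl (fun=> erefl) (fun=> ry j).
rewrite !subrK in h; apply: h => -[|//] _.
by rewrite addr0.
Qed.

Section atomistic.
Variable K : nat.
Let Y i : R := y (- K%:Z + i%:Z).
Local Notation n := (K.*2.+1).
Local Notation a := (aL K y).
Local Notation b := (aR K y).
Let S := \sum_(0 <= i < n) expR (- lam * Y i).
Let Sb := \sum_(0 <= i < n) expR (lam * Y i).

Let gap i : (i.+1 < n)%N -> e * vs0 <= Y i.+1 - Y i.
Proof.
move=> _; rewrite /Y; have := particle_gap (- K%:Z + i%:Z).
by rewrite (_ : - K%:Z + i%:Z + 1 = - K%:Z + i.+1%:Z)//; lia.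
Qed.

Let aLE : y (- K%:Z) - a = e * r (- K%:Z) / 2.
Proof.
rewrite -d1E /aL (_ : - K.+1%:Z = - K%:Z - 1); last lia.
by field.
Qed.

Let aRE : b - y K%:Z = e * r K.+1%:Z / 2.
Proof.
rewrite -d1E /aR (_ : K.+1%:Z - 1 = K%:Z); last lia.
by field.
Qed.

Let v0 : 0 < e * vs0. Proof. by rewrite mulr_gt0. Qed.

Let le_particle (i k : int) : i <= k -> y i <= y k.
Proof.
rewrite le_eqVlt => /predU1P[->//|/particle_sep]; have := v0; lra.
Qed.

Let aY i : (i < n)%N -> a + e * (vs0 / 2) <= Y i.
Proof.
move=> iN; have : y (- K%:Z) <= Y i by apply: le_particle; lia.
have : e * vs0 <= e * r (- K%:Z) by rewrite ler_pM2l.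
have := aLE; lra.
Qed.

Let Yb i : (i < n)%N -> Y i + e * (vs0 / 2) <= b.
Proof.
move=> iN; have : Y i <= y K%:Z by apply: le_particle; lia.
have : e * vs0 <= e * r K.+1%:Z by rewrite ler_pM2l.
have := aRE; lra.
Qed.

Let ab : a < b.
Proof. by have := @aY 0%N erefl; have := @Yb 0%N erefl; have := v0; lra. Qed.

Lemma rho_at_chain : rho_at delta1 N K y = chain_rho e delta1 Y n.
Proof.
apply/funext => x; rewrite /rho_at /sum_sym /chain_rho mulr_sumr.
by apply: eq_bigr => i _; rewrite delta_eps_mul /Y (addrC (- K%:Z)).
Qed.

(** On the region the absolute value in [green] has a fixed sign, so the integral is an increment of
    [chain_U]. *)
Lemma gammaLE : gammaL m delta1 N K y = kappa / m * (expR (lam * a) * S).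
Proof.
have hU := C1Z ((2 * e * m)^-1 * expR (lam * a)) (C1_chain_U e0 hp Y n).
have -> : gammaL m delta1 N K y = 2 * \int[mu]_(x in `]a, b[)
    ((2 * e * m)^-1 * expR (lam * a) * (expR (- lam * x) * chain_rho e delta1 Y n x)).
  rewrite /gammaL rho_at_chain; congr (_ * _); apply: eq_Rintegral => x.
  rewrite inE/= in_itv/= => /andP[ax _]; rewrite /green ger0_norm ?subr_ge0 ?ltW//.
  have -> : - lam * (x - a) = lam * a + - lam * x by ring.
  by rewrite expRD; ring.
rewrite (C1_FTC2 ab hU).
have [-> _ _] := chain_left m kappa e0 left0 aY.
have [-> _ _] := chain_right m e0 right0 Yb.
by rewrite -/S; field; rewrite m_neq0 e_neq0.
Qed.

Lemma gammaRE : gammaR m delta1 N K y = kappa / m * (expR (- lam * b) * Sb).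
Proof.
have hV := C1Z ((2 * e * m)^-1 * expR (- lam * b)) (C1_chain_V e0 hw Y n).
have -> : gammaR m delta1 N K y = 2 * \int[mu]_(x in `]a, b[)
    ((2 * e * m)^-1 * expR (- lam * b) * (expR (lam * x) * chain_rho e delta1 Y n x)).
  rewrite /gammaR rho_at_chain; congr (_ * _); apply: eq_Rintegral => x.
  rewrite inE/= in_itv/= => /andP[_ xb]; rewrite /green ger0_norm ?subr_ge0 ?ltW//.
  have -> : - lam * (b - x) = - lam * b + lam * x by ring.
  by rewrite expRD; ring.
rewrite (C1_FTC2 ab hV).
have [_ -> _] := chain_left m kappa e0 left0 aY.
have [_ -> _] := chain_right m e0 right0 Yb.
by rewrite -/Sb; field; rewrite m_neq0 e_neq0.
Qed.

(** By [gammaLE] and [gammaRE] the prescribed traces are those of the zero-slope field, whose even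
    reflection is periodic; the factor 2 counts the two copies of the region. *)
Lemma energy_at_cvg :
  (fun k => Phi m (K.*2.+1 + K.*2.+1) (1 - K%:Z) k (fun j => r (fold K j))) @ \oo -->
  2 * ((2 * m / e * energy_at_star m delta1 N K y - n%:R * dinf) / kappa ^+ 2).
Proof.
have E := chain_dirichlet_energy m0 vs00 e0 supp hp hw hd left0 right0 gap ab aY Yb.
rewrite -/S -/Sb in E; set T := expR (- lam * (b - a)) in E.
have -> : energy_at_star m delta1 N K y =
   e / (2 * m) * (n%:R * dinf + kappa ^+ 2 *
    (\sum_(0 <= k < n) \sum_(0 <= i < k) expR (lam * (Y i - Y k)) + 2^-1 *
     (((expR (lam * a) * S) ^+ 2 + (expR (- lam * b) * Sb) ^+ 2 +
      2 * T * (expR (lam * a) * S) * (expR (- lam * b) * Sb)) / ((1 - T) * (1 + T))))).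
  rewrite -E /energy_at_star rho_at_chain /gL_star /gR_star gammaLE gammaRE.
  rewrite /tau /Da -/T; congr (dirichlet_energy _ _ _ _ _ _ _); ring.
pose X i := lam * Y i.
pose Z := reflected K X (lam * a) (lam * b).
have lab : lam * a < lam * b by rewrite ltr_pM2l// divr_gt0.
have hl i : (i < n)%N -> Z i = X i by exact: reflected_left.
have hr i : (i < n)%N -> Z (n + i)%N = 2 * (lam * b) - X (n.-1 - i)%N.
  exact: reflected_right.
have Zend : Z (n + n)%N = X 0%N + 2 * (lam * b - lam * a) by exact: reflected_end.
have XS i : X i.+1 - X i = m * r (1 - K%:Z + i%:Z).
  rewrite /X -mulrBr /Y (_ : - K%:Z + i%:Z = - K%:Z + i.+1%:Z - 1); last lia.
  by rewrite d1E (_ : 1 - K%:Z + i%:Z = - K%:Z + i.+1%:Z); [field|lia].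
have X0 : 2 * (X 0%N - lam * a) = m * r (- K%:Z).
  rewrite /X /Y addr0; transitivity (2 * lam * (y (- K%:Z) - a)); first ring.
  by rewrite aLE; field.
have XK : 2 * (lam * b - X K.*2) = m * r K.+1%:Z.
  rewrite /X /Y (_ : - K%:Z + K.*2%:Z = K%:Z); last lia.
  transitivity (2 * lam * (b - y K%:Z)); first ring.
  by rewrite aRE; field.
have hZ := reflected_bond XS X0 XK.
have L := @Phi_cvg R m vs0 (n + n) (1 - K%:Z) (fun j => r (fold K j)) Z m0 vs00 erefl
  (fun j => congr1 r (fold_periodic K j)) (fun j => ry _) hZ.
move: L; congr (_ --> _).
have -> : expR (- (Z (n + n)%N - Z 0%N)) = expR (- (2 * (lam * b - lam * a))).
  by rewrite Zend (hl 0%N)//; congr expR; ring.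
rewrite (reflected_chain_sum lab hl hr).
have -> : expR (- (lam * b - lam * a)) = T by congr expR; ring.
have -> : expR (- (lam * b)) = expR (- lam * b) by rewrite mulNr.
have -> : \sum_(0 <= i < n) expR (- X i) = S.
  by apply: eq_bigr => i _; rewrite mulNr.
rewrite -/Sb.
have -> : \sum_(0 <= k < n) \sum_(0 <= i < k) expR (X i - X k) =
    \sum_(0 <= k < n) \sum_(0 <= i < k) expR (lam * (Y i - Y k)).
  by apply: eq_bigr => k _; apply: eq_bigr => i _; rewrite mulrBr.
have T0 : 0 < T := expR_gt0 _.
have T1 : T < 1 by rewrite expR_lt1 mulNr oppr_lt0 mulr_gt0 ?divr_gt0 ?subr_gt0.
field.
by rewrite subr_eq0 (gt_eqF T1) m_neq0 e_neq0 !lt0r_neq0// addr_gt0.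
Qed.

End atomistic.

Lemma energy_ac_cvg K : (K < N)%N ->
  (fun k => Phi_ac m K N k r) @ \oo -->
  (2 * m / e * energy_ac m delta1 N K y -
   acsum K N (fun=> dinf) (2 * ((K.*2.+1)%:R * dinf))) / kappa ^+ 2.
Proof.
move=> KN.
have cvg_acsum (G : int -> nat -> R) (G' : int -> R) H H' :
    (forall j, G j @ \oo --> G' j) -> H @ \oo --> H' ->
    (fun k => acsum K N (fun j => G j k) (H k)) @ \oo --> acsum K N G' H'.
  move=> hG hH; rewrite /acsum.
  have cs (s : seq nat) (f : nat -> int) :
      (fun k => \sum_(i <- s) G (f i) k) @ \oo --> \sum_(i <- s) G' (f i).
    elim: s => [|i s ih].
      by under eq_fun do rewrite big_nil; rewrite big_nil; exact: cvg_cst.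
    under eq_fun do rewrite big_cons; rewrite big_cons.
    by apply: cvgD; [exact: hG|exact: ih].
  apply: cvgD; last exact: cvgMl hH.
  apply: cvgD; last exact: cs.
  apply: cvgD; last exact: cvgMl (hG _).
  apply: cvgD; last exact: cvgMl (hG _).
  exact: cs.
have := cvg_acsum _ _ _ _ (fun j => energy_cb_cell_cvg (j := j)) (energy_at_cvg (K := K)).
rewrite /Phi_ac; congr (_ --> _).
have -> : energy_ac m delta1 N K y =
    acsum K N (energy_cb_cell m delta1 N y) (2 * energy_at_star m delta1 N K y).
  by rewrite /energy_ac /energy_cb_star /acsum (mulrC 2) mulfK.
rewrite -acsumZ -acsumB [RHS]mulrC -acsumZ; congr (acsum _ _ _ _).
  by apply/funext => j; rewrite mul1r mulrC.
by field; rewrite e_neq0 lt0r_neq0.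
Qed.

End chain_energies.

(** * Segments of deformations and the weighted norm *)

Section deformation_segments.
Variable R : realType.
Implicit Types (F t : R) (N K : nat) (y z f : int -> R).

Definition segment y z t : int -> R := fun j => y j + t * (z j - y j).

Lemma segment0 y z : segment y z 0 = y.
Proof. by apply/funext => j; rewrite /segment mul0r addr0. Qed.

Lemma segment1 y z : segment y z 1 = z.
Proof. by apply/funext => j; rewrite /segment mul1r subrKC. Qed.

Lemma sum_symD n (u v : int -> R) :
  sum_sym n (fun j => u j + v j) = sum_sym n u + sum_sym n v.
Proof. by rewrite /sum_sym big_split. Qed.

Lemma sum_symZ n a (u : int -> R) :
  sum_sym n (fun j => a * u j) = a * sum_sym n u.
Proof. by rewrite /sum_sym mulr_sumr. Qed.

Lemma sum_symB n (u v : int -> R) :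
  sum_sym n (fun j => u j - v j) = sum_sym n u - sum_sym n v.
Proof. by rewrite /sum_sym sumrB. Qed.

Lemma deformations_segment F N y z t : deformations F N y -> deformations F N z ->
  deformations F N (segment y z t).
Proof.
move=> [u [up u0] yE] [v [vp v0] zE]; exists (segment u v t).
  split; first by move=> j; rewrite /segment up vp.
  by rewrite /segment sum_symD sum_symZ sum_symB u0 v0 subr0 mulr0 addr0.
by move=> j; rewrite /segment yE zE; ring.
Qed.

Lemma d1_segment N y z t : d1 N (segment y z t) = segment (d1 N y) (d1 N z) t.
Proof. by apply/funext => j; rewrite /segment /d1; ring. Qed.

Lemma pairing_segment N f y z t :
  pairing N f (segment y z t) = pairing N f y + t * (pairing N f z - pairing N f y).
Proof.
rewrite /pairing (_ : sum_sym N (fun j => f j * segment y z t j) =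
  sum_sym N (fun j => f j * y j + t * (f j * z j - f j * y j))).
  by rewrite sum_symD sum_symZ sum_symB; ring.
by apply: eq_bigr => j _; rewrite /segment; ring.
Qed.

Lemma d1_periodic F N y j : deformations F N y ->
  d1 N y (j + (N.*2.+1)%:Z) = d1 N y j.
Proof.
move=> [u [up _] yE]; rewrite /d1 !yE (addrAC j) !up; congr (_ / _).
by rewrite !intrD; ring.
Qed.

Lemma d2E N y j : eps R N * d2 N y j = d1 N y (j + 1) - d1 N y j.
Proof. by rewrite /d1 /d2 addrK; field; rewrite lt0r_neq0// eps_gt0. Qed.

(** Inside, the distance to the nearer of -K and K is the depth K - |j|; outside, truncated
    subtraction gives exponent 0. *)
Lemma weightE (m s0 : R) K j : weight m s0 K j = expR (- m * s0) ^+ (K - `|j|%N).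
Proof.
rewrite /weight; case: ifPn => Kj.
  by rewrite (_ : (K - `|j|%N)%N = 0%N) ?expr0//; lia.
rewrite -expRM_natl; congr expR.
rewrite (_ : Num.min _ _ = (K - `|j|%N)%N%:Z); first by rewrite mulrC.
by rewrite minEle; case: ifP; lia.
Qed.

End deformation_segments.

Unset Implicit Arguments.

Theorem theorem5p6 (R : realType) (m vs0 : R) (delta1 : R -> R) (s0 : R)
    (hm : 0 < m) (hvs0 : 0 < vs0) (hdelta1 : charge_profile vs0 delta1)
    (hs0 : vs0 <= s0) :
  exists2 c : R, 0 < c &
  forall S0 : R, exists2 C : R, 0 < C &
  forall (F : R) (N K : nat) (f y yac : int -> R),
    0 < F -> (K < N)%N ->
    argmin [set z | deformations F N z] (total_energy m delta1 N f) y ->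
    argmin [set z | deformations F N z /\ forall j, 0 < d1 N z j]
      (total_energy_ac m delta1 N K f) yac ->
    (forall j, s0 <= d1 N y j) -> (forall j, s0 <= d1 N yac j) ->
    (forall j, d1 N y j <= S0) -> (forall j, d1 N yac j <= S0) ->
    c * ln S0 <= Da K y -> c * ln S0 <= Da K yac ->
    norm_l2 N (fun j => d1 N y j - d1 N yac j)
      <= C * (eps R N * wnorm_l2 m s0 N K (d2 N y) + tau m N K y).
Proof.
have [p [w [d [kappa [dinf [kappa0 [hp hw hd] left0 right0]]]]]] :=
  charge_profile_primitives hm hvs0 hdelta1.
have supp x : delta1 x != 0 -> - (vs0 / 2) <= x <= vs0 / 2.
  by case: hdelta1 => _ _ _ + _; exact.
have s00 : 0 < s0 := lt_le_trans hvs0 hs0.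
exists 1 => // S0.
have [C C0 stab] := chain_stability S0 hm s00.
exists (Num.sqrt C); first by rewrite sqrtr_gt0.
move=> F N K f y yac F0 KN [dy miny] [[dyac pyac] minac] ys yacs yS yacS _ _.
have e0 : 0 < eps R N := eps_gt0 R N.
pose Y t := segment y yac t.
have dY t : deformations F N (Y t) by exact: deformations_segment.
have Ys t : 0 <= t <= 1 -> forall j, s0 <= d1 N (Y t) j.
  move=> /andP[t0 t1] j; rewrite d1_segment /segment.
  by have := ys j; have := yacs j; nra.
have Yper t j : d1 N (Y t) (j + (N.*2.+1)%:Z) = d1 N (Y t) j.
  exact: d1_periodic (dY t).
pose a := 2 * m / eps R N / kappa ^+ 2.
have a0 : 0 < a by rewrite !divr_gt0 ?mulr_gt0 ?exprn_gt0.
have rv t : 0 <= t <= 1 -> forall j, vs0 <= d1 N (Y t) j.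
  by move=> t01 j; exact: le_trans (Ys t t01 j).
have cE t (t01 : 0 <= t <= 1) := energy_cvg hm hvs0 kappa0 supp hp hw hd left0 right0
  (rv t t01) (Yper t).
have cA t (t01 : 0 <= t <= 1) := energy_ac_cvg hm hvs0 kappa0 supp hp hw hd left0 right0
  (rv t t01) KN.
have diff : sum_sym N (fun j => (d1 N yac j - d1 N y j) ^+ 2) <= C *
    sum_sym N (fun j => expR (- m * s0) ^+ (K - `|j|%N) *
                        (d1 N y (j + 1) - d1 N y j) ^+ 2).
  apply: stab => //.
  - by move=> j; exact: d1_periodic dy.
  - by move=> j; exact: d1_periodic dyac.
  - by move=> j; rewrite ys yS.
  - by move=> j; rewrite yacs yacS.
  move=> t /andP[t0 t1].
  have t01 : 0 <= t <= 1 by rewrite !ltW.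
  have t01' : 0 <= 1 - t <= 1 by apply/andP; split; lra.
  have i0 : 0 <= (0 : R) <= 1 by rewrite lexx ler01.
  have i1 : 0 <= (1 : R) <= 1 by rewrite lexx ler01.
  have L := cvgB (cvgB (cE t t01) (cE 0 i0)) (cvgB (cA 1 i1) (cA (1 - t) t01')).
  rewrite !d1_segment !segment0 !segment1 in L.
  have -> : (fun j => d1 N y j + (d1 N yac j - d1 N y j)) = d1 N yac.
    by apply/funext => j; rewrite subrKC.
  eexists; last exact: L.
  (* In this combination of four limits the self-interaction constants cancel and a positive
     multiple of energy differences remains. *)
  set l := (X in 0 <= X).
  have -> : l = a * (energy m delta1 N (Y t) - energy m delta1 N y
     - (energy_ac m delta1 N K yac - energy_ac m delta1 N K (Y (1 - t)))).
    rewrite /l /a /Y segment0 segment1.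
    move: (energy _ _ _ _) (energy _ _ _ _) (energy_ac _ _ _ _ _) => E1 E2 E3.
    move: (energy_ac _ _ _ _ _) (acsum _ _ _ _) => E4 E5.
    by field; rewrite !lt0r_neq0.
  rewrite mulr_ge0 ?(ltW a0)//.
  (* The pairing is affine along the segment, so the force enters the two minimality inequalities
     with opposite signs and drops out of their sum. *)
  have h1 := miny _ (dY t).
  have pY : forall j, 0 < d1 N (Y (1 - t)) j.
    by move=> j; exact: lt_le_trans (Ys _ t01' j).
  have h2 := minac _ (conj (dY (1 - t)) pY).
  move: h1 h2; rewrite /total_energy /total_energy_ac !pairing_segment.
  lra.
have wE : eps R N ^+ 2 * sum_sym N (fun j => weight m s0 K j * d2 N y j ^+ 2) =
    sum_sym N (fun j => expR (- m * s0) ^+ (K - `|j|%N) *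
                        (d1 N y (j + 1) - d1 N y j) ^+ 2).
  rewrite -sum_symZ; apply: eq_bigr => i _.
  by rewrite weightE -d2E; ring.
apply: (@le_trans _ _ (Num.sqrt C * (eps R N * wnorm_l2 m s0 N K (d2 N y)))).
  rewrite /norm_l2 /wnorm_l2 -[X in X * Num.sqrt _](ger0_norm (ltW e0)) -sqrtr_sqr.
  rewrite -!sqrtrM ?sqr_ge0 ?(ltW C0)//; apply: ler_wsqrtr.
  rewrite [X in _ <= C * X]mulrCA wE mulrCA ler_pM2l//.
  apply: le_trans diff; rewrite le_eqVlt; apply/orP; left; apply/eqP.
  by apply: eq_bigr => i _; rewrite -sqrrN opprB.
by rewrite ler_wpM2l ?sqrtr_ge0// lerDl expR_ge0.
Qed.
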